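(* Let $\mathcal{P}$ be a pseudo order ideal in $P$ with $\mu$ elements and pseudo border $b\mathcal{P}$ with $\alpha$ elements. Let $I\subset P$ be an ideal such that $\mathcal{P}$ is a basis modulo $I$, let $\varphi_A$ be the generic linear change of coordinates, let $\bar I=I\cdot K[a_{ij}]_\Delta[x_1,\dots,x_n]$, and let $W$ be the Zariski-open subset of $\mathbb{L}$ consisting of all points representing linear changes of coordinates $\varphi$ such that the matrix $M_\varphi$ is invertible. (a) The open set $W$ is non-empty. (b) Let $M_{\varphi_A}\in\mathrm{Mat}_\mu(K[a_{ij}]_\Delta)$ be such that $\varphi_A^{-1}(\mathcal{P})\equiv\mathcal{P}\cdot M_{\varphi_A}\pmod{\bar I}$, and let $\Lambda=\det(M_{\varphi_A})$. Then the coordinate ring of $W$ is $K[a_{ij}]_{\Delta\cdot\Lambda}$. (c) Let $N_{\varphi_A}\in\mathrm{Mat}_{\mu,\alpha}(K[a_{ij}]_\Delta)$ be such that $\varphi_A^{-1}(b\mathcal{P})\equiv\mathcal{P}\cdot N_{\varphi_A}\pmod{\bar I}$. The entries of the matrix $M_{\varphi_A}^{-1}\cdot N_{\varphi_A}$ are contained in $K[a_{ij}]_{\Delta\cdot\Lambda}$. Hence there exists a well-defined $K$-algebra homomorphism $\psi:B_{\mathcal{P}}\to K[a_{ij}]_{\Delta\cdot\Lambda}$ which satisfies $\psi(c_{ij})=(M_{\varphi_A}^{-1}\cdot N_{\varphi_A})_{i,j}$ for all $i,j$. (d) The map $\psi$ induces a morphism $\Phi:W\to\mathbb{B}_{\mathcal{P}}$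 of affine schemes which is defined as follows: if $p\in W$ (resp. the corresponding matrix $\mathcal{A}$) represents a linear change of coordinates $\varphi:P\to P$, then $\Phi(p)$ is represented by $C_{\varphi(I)}=M_\varphi^{-1}\cdot N_\varphi$. (e) The map $\psi$ induces a flat family $\Psi:K[a_{ij}]_{\Delta\cdot\Lambda}\to U_{\mathcal{P}}\otimes_{B_{\mathcal{P}}}K[a_{ij}]_{\Delta\cdot\Lambda}$, i.e. this canonical ring homomorphism is flat.
   Context: $K$ is a field, $P=K[x_1,\dots,x_n]$, and $\mathbb{T}^n$ is the monoid of terms (power products). A linear change of coordinates is a $K$-algebra automorphism $\varphi:P\to P$ mapping each indeterminate to a (not necessarily homogeneous) linear polynomial. An order ideal is a finite nonempty set $\mathcal{O}\subset\mathbb{T}^n$ closed under forming divisors. Its border is $\partial\mathcal{O}=(x_1\mathcal{O}\cup\cdots\cup x_n\mathcal{O})\setminus\mathcal{O}$. Its corner set $c\mathcal{O}$ is the set of minimal monomial generators of $\mathbb{T}^n\setminus\mathcal{O}$. For a term ordering $\sigma$, $\mathcal{O}$ is a $\sigma$-cornercut if $b>_\sigma t$ for all $b\in c\mathcal{O}$ and $t\in\mathcal{O}$. A set of polynomials $\mathcal{P}=\{t_1,\dots,t_\mu\}$ is a pseudo order ideal with pseudo border $b\mathcal{P}=\{b_1,\dots,b_\alpha\}$ if one of the following holds for some linear change of coordinates $\phi$: (i) $\mathcal{P}=\phi(\mathcal{O})$ for an order ideal $\mathcal{O}$ and $b\mathcal{P}=\phi(\partial\mathcal{O})$; or (ii)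 $\mathcal{P}=\phi(\mathcal{O})$ for a $\sigma$-cornercut $\mathcal{O}$ and $b\mathcal{P}=\phi(c\mathcal{O})$. $\mathcal{P}$ is a basis modulo $I$ if the residue classes of its elements form a $K$-basis of $P/I$; then $C_I\in\mathrm{Mat}_{\mu,\alpha}(K)$ with $b\mathcal{P}\equiv\mathcal{P}\cdot C_I\pmod I$ is the matrix representing $I$ in $\mathbb{B}_{\mathcal{P}}$ (sets are treated as row vectors). Let $c_{ij}$ ($1\le i\le\mu$, $1\le j\le\alpha$) be indeterminates and $g_j=b_j-\sum_ic_{ij}t_i$. For an order ideal $\mathcal{O}=\{o_1,\dots,o_\mu\}$ with border $\{\beta_1,\dots,\beta_\nu\}$, the formal multiplication matrix $\mathcal{A}_k$ ($1\le k\le n$) is the $\mu\times\mu$ matrix whose $m$-th column is the $i$-th standard basis vector if $x_ko_m=o_i$, and $(c_{1j},\dots,c_{\mu j})^{\rm tr}$ if $x_ko_m=\beta_j$; $I(\mathbb{B}_{\mathcal{O}})$ is generated by the entries of all $\mathcal{A}_k\mathcal{A}_\ell-\mathcal{A}_\ell\mathcal{A}_k$. In case (i) with $t_i=\phi(o_i)$, $b_j=\phi(\beta_j)$, set $I(\mathbb{B}_{\mathcal{P}})=I(\mathbb{B}_{\mathcal{O}})$; in case (ii) set $I(\mathbb{B}_{\mathcal{P}})=I(\mathbb{B}_{\mathcal{O}})\cap K[c_{ij}\mid\beta_j\in c\mathcal{O}]$. Then $B_{\mathcal{P}}=K[c_{ij}]/I(\mathbb{B}_{\mathcal{P}})$,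 $\mathbb{B}_{\mathcal{P}}=\mathrm{Spec}(B_{\mathcal{P}})$, and $U_{\mathcal{P}}=K[x_1,\dots,x_n,c_{ij}]/(I(\mathbb{B}_{\mathcal{P}})+(g_1,\dots,g_\alpha))$. The $K$-rational points of $\mathbb{B}_{\mathcal{P}}$ correspond to the ideals modulo which $\mathcal{P}$ is a basis, via $I\mapsto C_I$. Let $a_{ij}$ ($i=1,\dots,n$, $j=0,\dots,n$) be new indeterminates and $\Delta=\det\bigl((a_{ij})_{i,j=1,\dots,n}\bigr)$. The generic linear change of coordinates is the $K[a_{ij}]$-algebra homomorphism $\varphi_A$ of $K[a_{ij}][x_1,\dots,x_n]$ with $x_i\mapsto a_{i0}+a_{i1}x_1+\cdots+a_{in}x_n$; it becomes an automorphism over $K[a_{ij}]_\Delta$. The scheme of linear coordinate changes is the open subscheme $\mathbb{L}=\mathrm{Spec}(K[a_{ij}]_\Delta)$ of $\mathbb{A}^{n(n+1)}$ given by $\Delta\neq0$. A linear change of coordinates $\varphi$ with $\varphi(x_i)=\alpha_{i0}+\alpha_{i1}x_1+\cdots+\alpha_{in}x_n$ is represented in $\mathbb{L}$ by the matrix $\mathcal{A}=(\alpha_{ij})$, or by the point with these coordinates. For such $\varphi$, $M_\varphi\in\mathrm{Mat}_\mu(K)$ and $N_\varphi\in\mathrm{Mat}_{\mu,\alpha}(K)$ are defined by $\varphi^{-1}(\mathcal{P})\equiv\mathcal{P}\cdot M_\varphi$ and $\varphi^{-1}(b\mathcal{P})\equiv\mathcal{P}\cdot N_\varphi\pmod I$.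 For a point of $\mathbb{L}$ that is not $K$-rational, $M_\varphi$ is formed in the same way after extending $K$ to the residue field of the point, and this is how membership in $W$ is understood. *)

(* Defs.v *)
From HB Require Import structures.
From mathcomp Require Import freeg.
From mathcomp Require Import all_boot all_order all_algebra.
From mathcomp Require Import generic_quotient ring_quotient.
From mathcomp Require Import boolp classical_sets.
From mathcomp Require Import mpoly.

Set Implicit Arguments.
Unset Strict Implicit.
Unset Printing Implicit Defensive.

Import Order.TTheory GRing.Theory.

Local Open Scope ring_scope.
Local Open Scope quotient_scope.

Record ideal (R : comPzRingType) := Ideal {
  ideal_set :> R -> Prop;
  ideal0 : ideal_set 0;
  idealD : forall x y, ideal_set x -> ideal_set y -> ideal_set (x + y);
  idealM : forall a x, ideal_set x -> ideal_set (a * x)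
}.

Section GeneratedIdeal.
Variables (R : comPzRingType) (E : R -> Prop).

Definition gen_ideal_set (x : R) : Prop :=
  forall J : ideal R, (forall y, E y -> J y) -> J x.

Fact gen_ideal0 : gen_ideal_set 0.
Proof. by move=> J _; apply: ideal0. Qed.

Fact gen_idealD x y :
  gen_ideal_set x -> gen_ideal_set y -> gen_ideal_set (x + y).
Proof. by move=> hx hy J EJ; apply: idealD; [apply: hx | apply: hy]. Qed.

Fact gen_idealM a x : gen_ideal_set x -> gen_ideal_set (a * x).
Proof. by move=> hx J EJ; apply: idealM; apply: hx. Qed.

Definition gen_ideal : ideal R := Ideal gen_ideal0 gen_idealD gen_idealM.

End GeneratedIdeal.

Section ComapIdeal.
Variables (R S : comPzRingType) (f : {rmorphism R -> S}) (J : ideal S).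

Fact comap0 : J (f 0). Proof. by rewrite rmorph0; apply: ideal0. Qed.
Fact comapD x y : J (f x) -> J (f y) -> J (f (x + y)).
Proof. by move=> hx hy; rewrite rmorphD; apply: idealD. Qed.
Fact comapM a x : J (f x) -> J (f (a * x)).
Proof. by move=> hx; rewrite rmorphM; apply: idealM. Qed.

Definition comap_ideal : ideal R :=
  @Ideal R (fun x => J (f x)) comap0 comapD comapM.

End ComapIdeal.

Section QuotientRing.
Variables (R : comPzRingType) (I : ideal R).

Definition ideal_pred : {pred R} := fun x => `[< I x >].

Lemma ideal_predP x : reflect (I x) (x \in ideal_pred).
Proof. exact: asboolP. Qed.

Lemma idealN x : I x -> I (- x).
Proof. by move=> Ix; rewrite -mulN1r; apply: idealM. Qed.

Fact ideal_zmod_closed : zmod_closed ideal_pred.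
Proof.
split=> [|x y /ideal_predP Ix /ideal_predP Iy]; first exact/ideal_predP/ideal0.
by apply/ideal_predP/idealD => //; apply: idealN.
Qed.

HB.instance Definition _ := GRing.isZmodClosed.Build R ideal_pred ideal_zmod_closed.

Definition quot_ring : Type := {ideal_quot ideal_pred}.

HB.instance Definition _ := GRing.Zmodule.on quot_ring.
HB.instance Definition _ : EqQuotient R (Quotient.equiv ideal_pred) quot_ring :=
  EqQuotient.on quot_ring.

Definition qproj (x : R) : quot_ring := \pi_quot_ring x.

Lemma qproj_eq x y : qproj x = qproj y <-> I (x - y).
Proof.
rewrite /qproj; split=> [/eqP|Ixy].
  by rewrite -[_ == _](@Quotient.idealrBE R ideal_pred) => /ideal_predP.
by apply/eqP; rewrite -[_ == _](@Quotient.idealrBE R ideal_pred); apply/ideal_predP.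
Qed.

Lemma qproj_surj (u : quot_ring) : exists x, u = qproj x.
Proof. by exists (repr u); rewrite /qproj reprK. Qed.

Fact qproj_zmod : zmod_morphism qproj.
Proof. by move=> x y; rewrite /qproj !piE. Qed.

HB.instance Definition _ :=
  GRing.isZmodMorphism.Build R quot_ring qproj qproj_zmod.

Definition qone : quot_ring := qproj 1.
Definition qmul (u v : quot_ring) : quot_ring := qproj (repr u * repr v).

Fact qmulE x y : qmul (qproj x) (qproj y) = qproj (x * y).
Proof.
have hr z : I (repr (qproj z) - z) by apply/qproj_eq; rewrite /qproj reprK.
apply/qproj_eq; set x' := repr _; set y' := repr _.
have -> : x' * y' - x * y = y' * (x' - x) + x * (y' - y).
  by rewrite !mulrBr (mulrC y') (mulrC y' x) addrA subrK.
by apply: idealD; apply: idealM; apply: hr.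
Qed.

Fact qmulA : associative qmul.
Proof.
move=> u v w; case: (qproj_surj u) (qproj_surj v) (qproj_surj w).
by move=> x -> [y ->] [z ->]; rewrite !qmulE mulrA.
Qed.

Fact qmulC : commutative qmul.
Proof.
move=> u v; case: (qproj_surj u) (qproj_surj v) => x -> [y ->].
by rewrite !qmulE mulrC.
Qed.

Fact qmul1 : left_id qone qmul.
Proof. by move=> u; case: (qproj_surj u) => x ->; rewrite qmulE mul1r. Qed.

Fact qmulDl : left_distributive qmul +%R.
Proof.
move=> u v w; case: (qproj_surj u) (qproj_surj v) (qproj_surj w).
by move=> x -> [y ->] [z ->]; rewrite -raddfD !qmulE mulrDl raddfD.
Qed.

HB.instance Definition _ :=
  GRing.Zmodule_isComPzRing.Build quot_ring qmulA qmulC qmul1 qmulDl.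

Fact qproj_monoid : monoid_morphism qproj.
Proof. by split=> [//|x y]; rewrite [RHS]qmulE. Qed.

HB.instance Definition _ :=
  GRing.isMonoidMorphism.Build R quot_ring qproj qproj_monoid.

End QuotientRing.

Section QuotientMap.
Variables (R S : comPzRingType) (I : ideal R) (J : ideal S).
Variable f : {rmorphism R -> S}.

Definition quot_map (fIJ : forall x, I x -> J (f x)) (u : quot_ring I) :
    quot_ring J := qproj J (f (repr u)).

Variable fIJ : forall x, I x -> J (f x).
Local Notation qmap := (quot_map fIJ).

Lemma quot_mapE x : qmap (qproj I x) = qproj J (f x).
Proof.
apply/qproj_eq; rewrite -rmorphB; apply: fIJ.
by apply/qproj_eq; rewrite /qproj reprK.
Qed.

Fact quot_map_zmod : zmod_morphism qmap.
Proof.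
move=> u v; case: (qproj_surj u) (qproj_surj v) => x -> [y ->].
by rewrite -raddfB !quot_mapE !raddfB.
Qed.

Fact quot_map_monoid : monoid_morphism qmap.
Proof.
split=> [|u v]; first by rewrite -[1](rmorph1 (qproj I)) quot_mapE !rmorph1.
case: (qproj_surj u) (qproj_surj v) => x -> [y ->].
by rewrite -rmorphM !quot_mapE !rmorphM.
Qed.

HB.instance Definition _ :=
  GRing.isZmodMorphism.Build (quot_ring I) (quot_ring J) qmap quot_map_zmod.
HB.instance Definition _ :=
  GRing.isMonoidMorphism.Build (quot_ring I) (quot_ring J) qmap
    quot_map_monoid.

End QuotientMap.

Arguments quot_map {R S I J} f fIJ u.

Record Spec (R : comPzRingType) := SpecPoint {
  Spec_ideal :> ideal R;
  Spec_one : ~ Spec_ideal 1;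
  Spec_prime : forall x y, Spec_ideal (x * y) -> Spec_ideal x \/ Spec_ideal y
}.

Section SpecMap.
Variables (R S : comPzRingType) (f : {rmorphism R -> S}) (q : Spec S).

Fact Spec_map_one : ~ comap_ideal f q 1.
Proof. by rewrite /= rmorph1; apply: Spec_one. Qed.

Fact Spec_map_prime x y :
  comap_ideal f q (x * y) -> comap_ideal f q x \/ comap_ideal f q y.
Proof. by rewrite /= rmorphM; apply: Spec_prime. Qed.

Definition Spec_map : Spec R := SpecPoint Spec_map_one Spec_map_prime.

End SpecMap.

Section ResidueField.
Variables (R : comNzRingType) (p : Spec R).

Definition quot_dom : Type := quot_ring p.

HB.instance Definition _ := GRing.ComPzRing.on quot_dom.

Fact quot_dom_one : (1 : quot_dom) != 0.
Proof.
apply/eqP=> h; apply: (@Spec_one _ p); rewrite -[1]subr0.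
by apply/(@qproj_eq _ p); rewrite rmorph1 rmorph0.
Qed.

HB.instance Definition _ := GRing.PzSemiRing_isNonZero.Build quot_dom quot_dom_one.

Definition qd_unit : {pred quot_dom} := fun u => `[< exists v, v * u = 1 >].
Definition qd_inv (u : quot_dom) : quot_dom :=
  if pselect (exists v, v * u = 1) is left h then projT1 (cid h) else u.

Fact qd_mulVr : {in qd_unit, left_inverse 1 qd_inv *%R}.
Proof.
move=> u /asboolP h; rewrite /qd_inv.
by case: pselect => // h'; case: cid.
Qed.

Fact qd_unitPl u v : v * u = 1 -> u \in qd_unit.
Proof. by move=> h; apply/asboolP; exists v. Qed.

Fact qd_invr_out : {in [predC qd_unit], qd_inv =1 id}.
Proof.
move=> u /negP h; rewrite /qd_inv; case: pselect => // h'.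
by case: h; apply/asboolP.
Qed.

HB.instance Definition _ :=
  GRing.ComNzRing_hasMulInverse.Build quot_dom qd_mulVr qd_unitPl qd_invr_out.

Fact quot_dom_integral : GRing.integral_domain_axiom quot_dom.
Proof.
move=> u v; case: (@qproj_surj _ p u) (@qproj_surj _ p v) => x -> [y ->].
move=> huv; have : qproj p (x * y) = qproj p 0 by rewrite rmorphM rmorph0.
move/qproj_eq; rewrite subr0 => /Spec_prime[] h; apply/orP; [left|right];
by apply/eqP; rewrite -[RHS](rmorph0 (qproj p)); apply/qproj_eq; rewrite subr0.
Qed.

HB.instance Definition _ :=
  GRing.ComUnitRing_isIntegral.Build quot_dom quot_dom_integral.

Definition residue_field : fieldType := {fraction quot_dom}.

Definition dom_proj : R -> quot_dom := qproj p.
HB.instance Definition _ := GRing.RMorphism.copy dom_proj (qproj p).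

Definition residue : R -> residue_field := @tofrac quot_dom \o dom_proj.
HB.instance Definition _ :=
  GRing.RMorphism.copy residue (@tofrac quot_dom \o dom_proj).

Lemma residue_eq0 x : residue x = 0 <-> p x.
Proof.
rewrite /residue /=; split=> [/eqP|px].
  rewrite tofrac_eq0 => /eqP h; have : qproj p x = qproj p 0.
    by rewrite rmorph0.
  by move/qproj_eq; rewrite subr0.
have -> : dom_proj x = 0; last exact: rmorph0.
by rewrite -(rmorph0 dom_proj); apply/(@qproj_eq _ p); rewrite subr0.
Qed.

End ResidueField.

(** For [f <> 0], [loc f] is the localization [D_f], as a subring of the
    fraction field of [D]. For [f = 0] the convention [x / 0 = 0] makes it [D]
    instead of the zero ring. *)

Section Localization.
Variables (D : idomainType) (f : D).

Definition loc_pred : {pred {fraction D}} :=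
  fun x => `[< exists a k, x = tofrac a / tofrac f ^+ k >].

Lemma loc_predP x :
  reflect (exists a k, x = tofrac a / tofrac f ^+ k) (x \in loc_pred).
Proof. exact: asboolP. Qed.

Fact loc_subring : subring_closed loc_pred.
Proof.
split=> [|x y /loc_predP[a [k ->]] /loc_predP[b [l ->]]
         |x y /loc_predP[a [k ->]] /loc_predP[b [l ->]]].
- by apply/loc_predP; exists 1, 0; rewrite expr0 divr1 rmorph1.
- have [f0|f0] := eqVneq f 0.
    rewrite {}f0 rmorph0 !expr0n; apply/loc_predP.
    by case: eqP => _; case: eqP => _; rewrite ?invr0 ?mulr0 ?divr1 ?subr0 ?sub0r;
       [exists (a - b), 0 | exists a, 0 | exists (- b), 0 | exists 0, 0];
       rewrite ?expr0 ?divr1 ?rmorphB ?rmorphN ?rmorph0.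
  have F0 : tofrac f != 0 :> {fraction D} by rewrite tofrac_eq0.
  apply/loc_predP; exists (a * f ^+ l - b * f ^+ k), (k + l).
  rewrite rmorphB !rmorphM !rmorphXn exprD mulrBl invfM.
  rewrite mulrACA divff ?expf_neq0 // mulr1; congr (_ - _).
  by rewrite mulrA -(mulrA (tofrac b)) divff ?expf_neq0 // mulr1.
- apply/loc_predP; exists (a * b), (k + l).
  by rewrite rmorphM exprD invfM mulrACA.
Qed.

HB.instance Definition _ :=
  GRing.isSubringClosed.Build {fraction D} loc_pred loc_subring.

Record loc := Loc { loc_val : {fraction D}; _ : loc_val \in loc_pred }.

HB.instance Definition _ := [isSub for loc_val].
HB.instance Definition _ := [Choice of loc by <:].
HB.instance Definition _ := [SubChoice_isSubComNzRing of loc by <:].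
HB.instance Definition _ :=
  GRing.RMorphism.copy loc_val (\val : loc -> {fraction D}).

Lemma loc_valP (x : loc) : loc_val x \in loc_pred. Proof. exact: valP x. Qed.

Definition loc_unit : {pred loc} :=
  fun x => (loc_val x != 0) && ((loc_val x)^-1 \in loc_pred).
Definition loc_inv (x : loc) : loc := 
  if x \in loc_unit then insubd x (loc_val x)^-1 else x.

Fact loc_mulVr : {in loc_unit, left_inverse 1 loc_inv *%R}.
Proof.
move=> x hx; rewrite /loc_inv hx; apply: val_inj.
by case/andP: hx => x0 xV; rewrite rmorphM rmorph1 /= insubdK // mulVf.
Qed.

Fact loc_unitPl x y : y * x = 1 -> x \in loc_unit.
Proof.
move/(congr1 loc_val); rewrite (rmorphM loc_val) (rmorph1 loc_val) => h.
have x0 : loc_val x != 0.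
  apply/eqP=> x0; have /eqP := oner_neq0 {fraction D}; apply.
  by rewrite -h; move: x0; rewrite /= => ->; rewrite mulr0.
apply/andP; split=> //.
have -> : (loc_val x)^-1 = loc_val y; last exact: loc_valP.
by apply: (mulIf x0); rewrite mulVf.
Qed.

Fact loc_invr_out : {in [predC loc_unit], loc_inv =1 id}.
Proof. by move=> x; rewrite /loc_inv inE => /negPf->. Qed.

HB.instance Definition _ :=
  GRing.ComNzRing_hasMulInverse.Build loc loc_mulVr loc_unitPl loc_invr_out.

Fact loc_integral : GRing.integral_domain_axiom loc.
Proof.
move=> x y /(congr1 loc_val); rewrite (rmorphM loc_val) (rmorph0 loc_val).
by move/eqP; rewrite mulf_eq0 -!(rmorph0 loc_val) !(inj_eq val_inj).
Qed.

HB.instance Definition _ := GRing.ComUnitRing_isIntegral.Build loc loc_integral.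

Fact loc_in_subproof a : tofrac a \in loc_pred.
Proof. by apply/loc_predP; exists a, 0; rewrite expr0 divr1. Qed.

Definition loc_in (a : D) : loc := Loc (loc_in_subproof a).

Fact loc_in_zmod : zmod_morphism loc_in.
Proof. by move=> x y; apply: val_inj; rewrite /= rmorphB. Qed.
Fact loc_in_monoid : monoid_morphism loc_in.
Proof. by split=> [|x y]; apply: val_inj; rewrite /= ?rmorph1 ?rmorphM. Qed.

HB.instance Definition _ := GRing.isZmodMorphism.Build D loc loc_in loc_in_zmod.
HB.instance Definition _ :=
  GRing.isMonoidMorphism.Build D loc loc_in loc_in_monoid.

Lemma loc_in_unit : f != 0 -> loc_in f \is a GRing.unit.
Proof.
move=> f0; apply/andP; split; first by rewrite /= tofrac_eq0.
by apply/loc_predP; exists 1, 1; rewrite rmorph1 expr1 mul1r.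
Qed.

End Localization.

Section Tensor.
Variables (R : comPzRingType) (M N : lmodType R).

Definition tensor_free : Type := {freeg (M * N)%type / int}.
HB.instance Definition _ := GRing.Lmodule.on tensor_free.

Definition tensor_gen (m : M) (n : N) : tensor_free := << 1 *g (m, n) >>.

Inductive tensor_rel : tensor_free -> Prop :=
| TensorAddl m m' n :
    tensor_rel (tensor_gen (m + m') n - (tensor_gen m n + tensor_gen m' n))
| TensorAddr m n n' :
    tensor_rel (tensor_gen m (n + n') - (tensor_gen m n + tensor_gen m n'))
| TensorScale a m n :
    tensor_rel (tensor_gen (a *: m) n - tensor_gen m (a *: n)).

Definition tensor_null : {pred tensor_free} := fun x =>
  `[< forall H : tensor_free -> Prop, H 0 ->
      (forall u v, H u -> H v -> H (u - v)) ->
      (forall u, tensor_rel u -> H u) -> H x >].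

Lemma tensor_nullP x :
  reflect (forall H : tensor_free -> Prop, H 0 ->
      (forall u v, H u -> H v -> H (u - v)) ->
      (forall u, tensor_rel u -> H u) -> H x) (x \in tensor_null).
Proof. exact: asboolP. Qed.

Fact tensor_null_closed : zmod_closed tensor_null.
Proof.
split=> [|x y /tensor_nullP hx /tensor_nullP hy]; apply/tensor_nullP => H H0 HB Hrel //.
by apply: (HB); [exact: (hx H) | exact: (hy H)].
Qed.

HB.instance Definition _ :=
  GRing.isZmodClosed.Build tensor_free tensor_null tensor_null_closed.

Definition tensor : Type := {ideal_quot tensor_null}.
HB.instance Definition _ := GRing.Zmodule.on tensor.
HB.instance Definition _ :
    EqQuotient tensor_free (Quotient.equiv tensor_null) tensor :=
  EqQuotient.on tensor.

Definition tensor_proj (x : tensor_free) : tensor := \pi_tensor x.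

Fact tensor_proj_zmod : zmod_morphism tensor_proj.
Proof. by move=> x y; rewrite /tensor_proj !piE. Qed.
HB.instance Definition _ :=
  GRing.isZmodMorphism.Build tensor_free tensor tensor_proj tensor_proj_zmod.

Definition pure (m : M) (n : N) : tensor := tensor_proj (tensor_gen m n).

Lemma tensor_proj_eq x y :
  tensor_proj x = tensor_proj y <-> x - y \in tensor_null.
Proof.
rewrite /tensor_proj; split=> [/eqP|h].
  by rewrite -[_ == _](@Quotient.idealrBE _ tensor_null).
by apply/eqP; rewrite -[_ == _](@Quotient.idealrBE _ tensor_null).
Qed.

Lemma tensor_rel0 x : tensor_rel x -> tensor_proj x = 0.
Proof.
move=> hx; rewrite -(raddf0 tensor_proj); apply/tensor_proj_eq.
by rewrite subr0; apply/tensor_nullP => H _ _; apply.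
Qed.

Lemma pureDl m m' n : pure (m + m') n = pure m n + pure m' n.
Proof.
apply/eqP; rewrite -subr_eq0 -raddfD -raddfB; apply/eqP/tensor_rel0.
exact: TensorAddl.
Qed.

Lemma pureDr m n n' : pure m (n + n') = pure m n + pure m n'.
Proof.
apply/eqP; rewrite -subr_eq0 -raddfD -raddfB; apply/eqP/tensor_rel0.
exact: TensorAddr.
Qed.

Lemma pureZ a m n : pure (a *: m) n = pure m (a *: n).
Proof.
by apply/eqP; rewrite -subr_eq0 -raddfB; apply/eqP/tensor_rel0/TensorScale.
Qed.

Lemma tensor_ind (P : tensor -> Prop) :
  P 0 -> (forall x y, P x -> P y -> P (x - y)) ->
  (forall m n, P (pure m n)) -> forall x, P x.
Proof.
move=> P0 PB Pp x.
have PN y : P y -> P (- y) by move=> Py; rewrite -sub0r; apply: PB.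
have PD y z : P y -> P z -> P (y + z).
  by move=> Py Pz; rewrite -[z]opprK; apply: PB => //; apply: PN.
have Pn y k : P y -> P (y *+ k).
  by move=> Py; elim: k => [|k IH]; rewrite ?mulr0n // mulrS; apply: PD.
have -> : x = tensor_proj (repr x) by rewrite /tensor_proj reprK.
rewrite -(freeg_sumE (repr x : {freeg _ / int})) raddf_sum.
apply: (big_ind P P0 PD) => -[m n] _.
have -> : << coeff (m, n) (repr x) *g (m, n) >>
   = tensor_gen m n *~ coeff (m, n) (repr x) :> tensor_free.
  by rewrite /tensor_gen freeg_mulz intz.
rewrite raddfMz /intmul; case: (coeff _ _) => k; first exact/Pn/Pp.
by apply/PN/Pn/Pp.
Qed.

Section Lift.
Variables (V : zmodType) (b : M -> N -> V).

Record balanced : Prop := Balanced {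
  balancedDl : forall m m' n, b (m + m') n = b m n + b m' n;
  balancedDr : forall m n n', b m (n + n') = b m n + b m n';
  balancedZ : forall a m n, b (a *: m) n = b m (a *: n)
}.

Definition free_lift (x : tensor_free) : V :=
  fglift (fun mn => b mn.1 mn.2 : zmodule V) x.

Definition tensor_lift (x : tensor) : V := free_lift (repr x).

Fact free_lift_zmod : zmod_morphism free_lift.
Proof. by move=> x y; exact: (@lift_is_additive int _ (zmodule V) _ x y). Qed.
HB.instance Definition _ :=
  GRing.isZmodMorphism.Build tensor_free V free_lift free_lift_zmod.

Hypothesis bP : balanced.

Lemma free_lift_gen m n : free_lift (tensor_gen m n) = b m n.
Proof. by rewrite /free_lift /tensor_gen liftU scale1r. Qed.

Lemma free_lift_null x : x \in tensor_null -> free_lift x = 0.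
Proof.
move/tensor_nullP/(_ (fun y => free_lift y = 0)); apply; first exact: raddf0.
  by move=> u v hu hv; rewrite raddfB /= hu hv subrr.
move=> _ [m m' n|m n n'|a m n] /=;
  rewrite (raddfB free_lift) ?(raddfD free_lift) /= !free_lift_gen.
- by rewrite (balancedDl bP) subrr.
- by rewrite (balancedDr bP) subrr.
- by rewrite (balancedZ bP) subrr.
Qed.

Lemma tensor_lift_proj x : tensor_lift (tensor_proj x) = free_lift x.
Proof.
apply/eqP; rewrite -subr_eq0 -raddfB; apply/eqP/free_lift_null/tensor_proj_eq.
by rewrite /tensor_proj reprK.
Qed.

Lemma tensor_liftE m n : tensor_lift (pure m n) = b m n.
Proof. by rewrite tensor_lift_proj free_lift_gen. Qed.

Lemma tensor_liftB : {morph tensor_lift : x y / x - y}.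
Proof.
move=> x y; have -> : x = tensor_proj (repr x) by rewrite /tensor_proj reprK.
have -> : y = tensor_proj (repr y) by rewrite /tensor_proj reprK.
by rewrite -raddfB !tensor_lift_proj raddfB.
Qed.

Lemma tensor_lift0 : tensor_lift 0 = 0.
Proof. by have := tensor_liftB 0 0; rewrite !subrr. Qed.

Lemma tensor_liftD : {morph tensor_lift : x y / x + y}.
Proof.
move=> x y; have hN z : tensor_lift (- z) = - tensor_lift z.
  by have := tensor_liftB 0 z; rewrite !sub0r tensor_lift0 sub0r.
by have := tensor_liftB x (- y); rewrite opprK hN opprK.
Qed.

End Lift.
End Tensor.

Arguments pure {R M N} m n.

Definition tensor_map (R : comPzRingType) (M M' N : lmodType R)
    (i : {linear M -> M'}) : tensor M N -> tensor M' N :=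
  tensor_lift (fun m n => pure (i m) n).

Arguments tensor_map {R M M'} N i.

Lemma tensor_map_balanced (R : comPzRingType) (M M' N : lmodType R)
    (i : {linear M -> M'}) :
  balanced (fun (m : M) (n : N) => pure (i m) n).
Proof.
split=> [m m' n|m n n'|a m n]; first by rewrite raddfD pureDl.
  by rewrite pureDr.
by rewrite linearZ pureZ.
Qed.

Definition flat (R : comPzRingType) (N : lmodType R) : Prop :=
  forall (M M' : lmodType R) (i : {linear M -> M'}),
    injective i -> injective (tensor_map N i).

Definition restr (R E : comPzRingType) (f : {rmorphism R -> E}) : Type := E.

Section RestrictScalars.
Variables (R E : comPzRingType) (f : {rmorphism R -> E}).

Local Notation rE := (restr f).
HB.instance Definition _ := GRing.Zmodule.copy rE E.

Definition restr_scale (a : R) (x : rE) : rE := f a * (x : E).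

Fact restr_scaleA a b x : restr_scale a (restr_scale b x) = restr_scale (a * b) x.
Proof. by rewrite /restr_scale rmorphM mulrA. Qed.
Fact restr_scale1 : left_id 1 restr_scale.
Proof. by move=> x; rewrite /restr_scale rmorph1 mul1r. Qed.
Fact restr_scaleDr : right_distributive restr_scale +%R.
Proof. by move=> a x y; apply: mulrDr. Qed.
Fact restr_scaleDl x : {morph restr_scale^~ x : a b / a + b}.
Proof. by move=> a b; rewrite /restr_scale rmorphD mulrDl. Qed.

HB.instance Definition _ := GRing.Zmodule_isLmodule.Build R rE
  restr_scaleA restr_scale1 restr_scaleDr restr_scaleDl.

Lemma restr_scaleE a x : a *: (x : rE) = f a * (x : E). Proof. by []. Qed.

End RestrictScalars.

Definition flat_rmorphism (R E : comPzRingType) (f : {rmorphism R -> E}) : Prop :=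
  flat (restr f).

Section AlgebraTensor.
Variables (B U T : comPzRingType) (f : {rmorphism B -> U}) (g : {rmorphism B -> T}).

Definition alg_tensor : Type := tensor (restr f) (restr g).
HB.instance Definition _ := GRing.Zmodule.on alg_tensor.

Definition apure (u : U) (t : T) : alg_tensor :=
  @pure B (restr f) (restr g) u t.

Definition at_scale (u' : U) (t' : T) : alg_tensor -> alg_tensor :=
  @tensor_lift B (restr f) (restr g) _ (fun u t => apure (u' * (u : U)) (t' * (t : T))).

Definition at_mul (x y : alg_tensor) : alg_tensor :=
  @tensor_lift B (restr f) (restr g) _ (fun u t => at_scale u t x) y.

Fact at_scale_balanced u' t' :
  balanced (fun (u : restr f) (t : restr g) => apure (u' * (u : U)) (t' * (t : T))).
Proof.
split=> [u v t|u t s|a u t]; rewrite /apure.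
- by rewrite [X in pure X]mulrDr pureDl.
- by rewrite [X in pure _ X]mulrDr pureDr.
- by rewrite !restr_scaleE (mulrCA u') (mulrCA t'); apply: (@pureZ _ (restr f) (restr g)).
Qed.

Lemma at_scaleE u' t' u t : at_scale u' t' (apure u t) = apure (u' * u) (t' * t).
Proof. by rewrite [LHS]tensor_liftE //; apply: at_scale_balanced. Qed.

Lemma at_scaleB u t : {morph at_scale u t : x y / x - y}.
Proof. by apply: tensor_liftB; apply: at_scale_balanced. Qed.

Lemma at_scale0 u t : at_scale u t 0 = 0.
Proof. by have := at_scaleB u t 0 0; rewrite !subrr. Qed.

Lemma apure_ind (P : alg_tensor -> Prop) :
  P 0 -> (forall x y, P x -> P y -> P (x - y)) ->
  (forall u t, P (apure u t)) -> forall x, P x.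
Proof. exact: tensor_ind. Qed.

Fact at_mul_balanced x :
  balanced (fun (u : restr f) (t : restr g) => at_scale u t x).
Proof.
elim/apure_ind: x => [|x y hx hy|u' t'].
- by split=> *; rewrite !at_scale0 ?addr0.
- split=> [u v t|u t s|a u t]; rewrite !at_scaleB.
  + by rewrite (balancedDl hx) (balancedDl hy) opprD addrACA.
  + by rewrite (balancedDr hx) (balancedDr hy) opprD addrACA.
  + by rewrite (balancedZ hx) (balancedZ hy).
split=> [u v t|u t s|a u t]; rewrite !at_scaleE /apure.
- by rewrite [X in pure X]mulrDl pureDl.
- by rewrite [X in pure _ X]mulrDl pureDr.
- by rewrite !restr_scaleE -!mulrA; apply: (@pureZ _ (restr f) (restr g)).
Qed.

Lemma at_mulE u t u' t' :
  at_mul (apure u t) (apure u' t') = apure (u * u') (t * t').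
Proof.
rewrite [LHS]tensor_liftE; last exact: at_mul_balanced.
by rewrite at_scaleE (mulrC u') (mulrC t').
Qed.

Lemma at_mulBr x : {morph at_mul x : y z / y - z}.
Proof. by apply: tensor_liftB; apply: at_mul_balanced. Qed.

Lemma at_mul0 x : at_mul x 0 = 0.
Proof. by have := at_mulBr x 0 0; rewrite !subrr. Qed.

Lemma at_mul_pure x u t : at_mul x (apure u t) = at_scale u t x.
Proof. by rewrite [LHS]tensor_liftE //; apply: at_mul_balanced. Qed.

Lemma at_mulBl y : {morph at_mul^~ y : x z / x - z}.
Proof.
elim/apure_ind: y => [|x y hx hy|u t] v w /=.
- by rewrite !at_mul0 subrr.
- by rewrite !at_mulBr hx hy !opprB addrACA [RHS]addrACA [- _ + _]addrC.
- by rewrite !at_mul_pure at_scaleB.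
Qed.

Lemma at_mul0l y : at_mul 0 y = 0.
Proof. by have := at_mulBl y 0 0; rewrite /= !subrr. Qed.

Fact at_mulC : commutative at_mul.
Proof.
move=> x; elim/apure_ind: x => [|x y hx hy|u t] z.
- by rewrite at_mul0l at_mul0.
- by rewrite at_mulBl at_mulBr hx hy.
elim/apure_ind: z => [|x y hx hy|u' t'].
- by rewrite at_mul0l at_mul0.
- by rewrite at_mulBl at_mulBr hx hy.
by rewrite !at_mulE mulrC (mulrC t).
Qed.

Fact at_mulA : associative at_mul.
Proof.
move=> x; elim/apure_ind: x => [|x y hx hy|u t] z w.
- by rewrite !at_mul0l.
- by rewrite !at_mulBl hx hy.
elim/apure_ind: z => [|x y hx hy|u' t'].
- by rewrite !(at_mul0l, at_mul0).
- by rewrite !(at_mulBl, at_mulBr) hx hy.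
elim/apure_ind: w => [|x y hx hy|u'' t''].
- by rewrite !at_mul0.
- by rewrite !at_mulBr hx hy.
by rewrite !at_mulE !mulrA.
Qed.

Fact at_mul1 : left_id (apure 1 1) at_mul.
Proof.
elim/apure_ind=> [|x y hx hy|u t]; first exact: at_mul0.
  by rewrite at_mulBr hx hy.
by rewrite at_mulE !mul1r.
Qed.

Fact at_mulDl : left_distributive at_mul +%R.
Proof.
move=> x y z; have hN w : at_mul (- w) z = - at_mul w z.
  by have := at_mulBl z 0 w; rewrite /= !sub0r at_mul0l sub0r.
by have := at_mulBl z x (- y); rewrite /= opprK hN opprK.
Qed.

HB.instance Definition _ :=
  GRing.Zmodule_isComPzRing.Build alg_tensor at_mulA at_mulC at_mul1 at_mulDl.

Definition alg_tensor_inr (t : T) : alg_tensor := apure 1 t.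

Fact alg_tensor_inr_zmod : zmod_morphism alg_tensor_inr.
Proof.
move=> x y; apply/eqP; rewrite -subr_eq; apply/eqP.
by rewrite opprK -[LHS]pureDr; congr pure; rewrite subrK.
Qed.

Fact alg_tensor_inr_monoid : monoid_morphism alg_tensor_inr.
Proof. by split=> [//|x y]; rewrite [RHS]at_mulE mulr1. Qed.

HB.instance Definition _ :=
  GRing.isZmodMorphism.Build T alg_tensor alg_tensor_inr alg_tensor_inr_zmod.
HB.instance Definition _ :=
  GRing.isMonoidMorphism.Build T alg_tensor alg_tensor_inr alg_tensor_inr_monoid.

End AlgebraTensor.

Local Open Scope classical_set_scope.

Definition zopen (R : comPzRingType) (U : set (Spec R)) : Prop :=
  exists E : set R, U = [set p : Spec R | exists2 f, E f & ~ p f].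

(** An element of the local ring [R_p] is given by a pair [x = (a, s)] with
    [~ p s], standing for [a / s]; two pairs give the same element when
    [same_germ p] holds. *)

Definition same_germ (R : comPzRingType) (p : Spec R) (x y : R * R) : Prop :=
  exists2 t, ~ p t & t * (x.1 * y.2 - y.1 * x.2) = 0.

(** Sections of the structure sheaf over [U]: functions to the local rings that
    are locally given by a single fraction (only the values on [U] matter). *)

Definition is_section (R : comPzRingType) (U : set (Spec R))
    (s : Spec R -> R * R) : Prop :=
  (forall p, U p -> ~ p (s p).2) /\
  (forall p, U p -> exists V, [/\ zopen V, V p, V `<=` U &
     exists x : R * R, forall q, V q -> ~ q x.2 /\ same_germ q (s q) x]).

Definition frac (D : idomainType) (x : D * D) : {fraction D} :=
  tofrac x.1 / tofrac x.2.

(** Over a domain [D], [O(W)] is the localization [D_f] via the inclusion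
    [D_f -> O(W)], and the open subscheme [W] is the affine scheme
    [Spec(D_f)] via the canonical map [Spec(D_f) -> Spec(D)]. *)

Definition has_coordinate_ring (D : idomainType) (W : set (Spec D)) (f : D) :
    Prop :=
  [/\ forall x : loc f, exists s, is_section W s /\
        (forall p, W p -> frac (s p) = loc_val x),
      forall s, is_section W s ->
        exists! x : loc f, forall p, W p -> frac (s p) = loc_val x &
      let j := Spec_map (loc_in f) in
      [/\ injective j, range j = W &
          forall V : set (Spec (loc f)), zopen V <-> zopen (j @` V)]].

(** [Phi] is the morphism of schemes from the open subscheme [W] of [Spec(D)]
    to [Spec(B)] induced by [g : B -> O(W)]; the elements of [O(W)] are
    represented by their values in the fraction field of [D]. The conditions
    are continuity, that [Phi p] is the preimage of the maximal ideal of the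
    local ring [D_p], and that the comorphism [b / s |-> g b / g s] maps
    sections over [V] to sections over the preimage of [V]. *)

Definition induced_morphism (D : idomainType) (W : set (Spec D))
    (B : comPzRingType) (g : B -> {fraction D}) (Phi : Spec D -> Spec B) :
    Prop :=
  [/\ forall V, zopen V -> zopen (W `&` Phi @^-1` V),
      forall p, W p -> forall b,
        Phi p b <-> exists x : D * D, [/\ p x.1, ~ p x.2 & g b = frac x] &
      forall V s, zopen V -> is_section V s ->
        exists s', is_section (W `&` Phi @^-1` V) s' /\
          forall p, (W `&` Phi @^-1` V) p ->
            frac (s' p) = g (s (Phi p)).1 / g (s (Phi p)).2].

Record lin_change (R : comNzRingType) (n : nat) := LinChange {
  lc_fun :> {lrmorphism {mpoly R[n]} -> {mpoly R[n]}};
  lc_inv : {mpoly R[n]} -> {mpoly R[n]};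
  lc_funK : cancel lc_fun lc_inv;
  lc_invK : cancel lc_inv lc_fun;
  lc_linear : forall i, (msize (lc_fun 'X_i) <= 2)%N
}.

(** Column [0] holds the constant terms, column [j + 1] the coefficients of the
    [j]-th indeterminate. *)

Definition lc_mx (R : comNzRingType) (n : nat) (phi : lin_change R n) :
    'M[R]_(n, n.+1) :=
  \matrix_(i < n, j < n.+1)
    if unlift ord0 j is Some k then (phi 'X_i)@_(U_(k)%MM)
    else (phi 'X_i)@_0%MM.

Definition lin_part (R : comNzRingType) (n : nat) (A : 'M[R]_(n, n.+1)) :
    'M[R]_n := \matrix_(i < n, j < n) A i (lift ord0 j).

Section MatrixChange.
Variables (R : comUnitRingType) (n : nat).

Definition affine_form (A : 'M[R]_(n, n.+1)) (i : 'I_n) : {mpoly R[n]} :=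
  (A i ord0)%:MP + \sum_(j < n) A i (lift ord0 j) *: 'X_j.

Definition lin_subst (A : 'M[R]_(n, n.+1)) : {mpoly R[n]} -> {mpoly R[n]} :=
  comp_mpoly [tuple affine_form A i | i < n].
HB.instance Definition _ (A : 'M[R]_(n, n.+1)) :=
  GRing.LRMorphism.copy (lin_subst A)
    (comp_mpoly [tuple affine_form A i | i < n]).

Definition inv_affine (A : 'M[R]_(n, n.+1)) : 'M[R]_(n, n.+1) :=
  \matrix_(i < n, j < n.+1)
    if unlift ord0 j is Some k then invmx (lin_part A) i k
    else - \sum_k invmx (lin_part A) i k * A k ord0.

Lemma lin_substX A i : lin_subst A 'X_i = affine_form A i.
Proof. by rewrite /lin_subst comp_mpolyXU -tnth_nth tnth_mktuple. Qed.

Lemma lin_subst_affine A B i :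
  lin_subst A (affine_form B i) =
  (B i ord0 + \sum_(k < n) B i (lift ord0 k) * A k ord0)%:MP
  + \sum_j (lin_part B *m lin_part A) i j *: 'X_j.
Proof.
rewrite /affine_form raddfD /= [lin_subst A _%:MP]comp_mpolyC raddf_sum /=.
rewrite mpolyCD -addrA; congr (_ + _).
under eq_bigr => k _ do rewrite linearZ /= lin_substX /affine_form scalerDr.
rewrite big_split /=; congr (_ + _).
  by rewrite raddf_sum; apply: eq_bigr => k _; rewrite /= -mul_mpolyC mpolyCM.
under eq_bigr => k _ do rewrite scaler_sumr.
rewrite exchange_big /=; apply: eq_bigr => j _.
rewrite mxE scaler_suml; apply: eq_bigr => k _.
by rewrite !mxE scalerA.
Qed.

Lemma lrmorph_id (h : {lrmorphism {mpoly R[n]} -> {mpoly R[n]}}) :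
  (forall i, h 'X_i = 'X_i) -> h =1 id.
Proof.
move=> hX p; have -> : h p = h (\sum_(m <- msupp p) p@_m *: 'X_[m]).
  by rewrite -mpolyE.
rewrite raddf_sum /= [RHS]mpolyE; apply: eq_bigr => m _; rewrite linearZ /=; congr (_ *: _).
by rewrite mpolyXE_id rmorph_prod; apply: eq_bigr => i _; rewrite rmorphXn /= hX.
Qed.

Lemma lin_part_inv A : lin_part (inv_affine A) = invmx (lin_part A).
Proof. by apply/matrixP => i j; rewrite !mxE liftK. Qed.

Lemma inv_affine0 A i :
  inv_affine A i ord0 = - \sum_k invmx (lin_part A) i k * A k ord0.
Proof. by rewrite mxE unlift_none. Qed.

Lemma inv_affineS A i (k : 'I_n) :
  inv_affine A i (lift ord0 k) = invmx (lin_part A) i k.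
Proof. by rewrite mxE liftK. Qed.

Section Invertible.
Variables (A : 'M[R]_(n, n.+1)) (uA : lin_part A \in unitmx).

Fact lin_subst_invK : cancel (lin_subst (inv_affine A)) (lin_subst A).
Proof.
apply: (@lrmorph_id (lin_subst A \o lin_subst (inv_affine A))) => i /=.
rewrite lin_substX lin_subst_affine lin_part_inv mulVmx // inv_affine0.
have -> : \sum_(k < n) inv_affine A i (lift ord0 k) * A k ord0
    = \sum_(k < n) invmx (lin_part A) i k * A k ord0.
  by apply: eq_bigr => k _; rewrite inv_affineS.
rewrite addNr mpolyC0 add0r (bigD1 i) //= mxE eqxx scale1r big1 ?addr0 // => j ji.
by rewrite mxE eq_sym (negPf ji) scale0r.
Qed.

Fact lin_substK : cancel (lin_subst A) (lin_subst (inv_affine A)).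
Proof.
apply: (@lrmorph_id (lin_subst (inv_affine A) \o lin_subst A)) => i /=.
rewrite lin_substX lin_subst_affine lin_part_inv mulmxV //.
have -> : \sum_(k < n) A i (lift ord0 k) * inv_affine A k ord0 = - A i ord0.
  under eq_bigr => k _ do rewrite inv_affine0 mulrN mulr_sumr.
  rewrite sumrN exchange_big /=; congr (- _).
  rewrite (eq_bigr (fun l => (lin_part A *m invmx (lin_part A)) i l * A l ord0)).
    rewrite mulmxV // (bigD1 i) //= mxE eqxx mul1r big1 ?addr0 // => l li.
    by rewrite mxE eq_sym (negPf li) mul0r.
  move=> l _; rewrite mxE mulr_suml; apply: eq_bigr => k _.
  by rewrite !mxE mulrA.
rewrite subrr mpolyC0 add0r (bigD1 i) //= mxE eqxx scale1r big1 ?addr0 // => j ji.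
by rewrite mxE eq_sym (negPf ji) scale0r.
Qed.

Fact lin_subst_linear i : (msize (lin_subst A 'X_i) <= 2)%N.
Proof.
rewrite lin_substX /affine_form; apply: (leq_trans (msizeD_le _ _)).
rewrite geq_max; apply/andP; split.
  by rewrite msizeC; case: (_ != 0).
apply: (leq_trans (msize_sum _ _ _)); apply/bigmax_leqP => j _.
by apply: (leq_trans (msizeZ_le _ _)); rewrite msizeX mdeg1.
Qed.

Definition mx_change : lin_change R n :=
  LinChange lin_substK lin_subst_invK lin_subst_linear.

End Invertible.
End MatrixChange.

Section Congruence.
Variables (R : comNzRingType) (n : nat).
Implicit Types (J : ideal {mpoly R[n]}) (phi : lin_change R n).

(** [(u_1, ..., u_a) = (t_1, ..., t_m) * M] modulo [J]. *)
Definition congr_mod m a J (u : 'I_a -> {mpoly R[n]}) (t : 'I_m -> {mpoly R[n]})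
    (M : 'M[R]_(m, a)) : Prop :=
  forall j, J (u j - \sum_(i < m) M i j *: t i).

Definition basis_mod m J (t : 'I_m -> {mpoly R[n]}) : Prop :=
  (forall f, exists c : 'I_m -> R, J (f - \sum_(i < m) c i *: t i)) /\
  (forall c : 'I_m -> R, J (\sum_(i < m) c i *: t i) -> forall i, c i = 0).

(** [phi^-1 (u) = t * M] modulo [J]. *)
Definition change_mx m a J phi (t : 'I_m -> {mpoly R[n]})
    (u : 'I_a -> {mpoly R[n]}) (M : 'M[R]_(m, a)) : Prop :=
  congr_mod J (fun j => lc_inv phi (u j)) t M.

Section ImageIdeal.
Variables (phi : lin_change R n) (J : ideal {mpoly R[n]}).

Let im (f : {mpoly R[n]}) : Prop := exists2 g, J g & f = phi g.

Fact image_ideal0 : im 0.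
Proof. by exists 0; [apply: ideal0 | rewrite rmorph0]. Qed.
Fact image_idealD x y : im x -> im y -> im (x + y).
Proof.
by move=> [g Jg ->] [h Jh ->]; exists (g + h); [apply: idealD | rewrite rmorphD].
Qed.
Fact image_idealM a x : im x -> im (a * x).
Proof.
move=> [g Jg ->]; exists (lc_inv phi a * g); first exact: idealM.
by rewrite rmorphM /= lc_invK.
Qed.

Definition image_ideal : ideal {mpoly R[n]} :=
  Ideal image_ideal0 image_idealD image_idealM.

End ImageIdeal.
End Congruence.

Definition ext_ideal (R S : comPzRingType) (f : R -> S) (I : ideal R) : ideal S :=
  gen_ideal (fun y => exists2 x, I x & y = f x).

Section OrderIdeals.
Variable n : nat.
Implicit Type o : seq 'X_{1..n}.

Definition order_ideal o : Prop :=
  [/\ uniq o, o != [::] &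
      forall m m' : 'X_{1..n}, m \in o -> (m' <= m)%MM -> m' \in o].

Definition border o : seq 'X_{1..n} :=
  [seq m <- undup [seq (U_(k) + m)%MM | k <- enum 'I_n, m <- o] | m \notin o].

Definition border_term o (j : 'I_(size (border o))) : 'X_{1..n} :=
  tnth (in_tuple (border o)) j.

Definition corner o (m : 'X_{1..n}) : Prop :=
  m \notin o /\
  forall m' : 'X_{1..n}, m' \notin o -> (m' <= m)%MM -> m' = m.

Definition term_ordering (le : rel 'X_{1..n}) : Prop :=
  [/\ reflexive le, antisymmetric le, transitive le & total le] /\
  (forall m, le 0%MM m) /\
  (forall m m1 m2, le m1 m2 -> le (m1 + m)%MM (m2 + m)%MM).

Definition cornercut (le : rel 'X_{1..n}) o : Prop :=
  forall b t, corner o b -> t \in o -> le t b /\ t <> b.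

End OrderIdeals.

Section BorderScheme.
Variables (K : fieldType) (n mu : nat) (o : mu.-tuple 'X_{1..n}).
Local Notation nu := (size (border o)).

Definition formal_mulmx (k : 'I_n) : 'M[{mpoly K[mu * nu]}]_mu :=
  \matrix_(i < mu, m < mu)
    let w := (U_(k) + tnth o m)%MM in
    if w \in val o then (w == tnth o i)%:R
    else if [pick j | w == border_term j] is Some j then 'X_(mxvec_index i j)
    else 0.

Definition border_ideal : ideal {mpoly K[mu * nu]} :=
  gen_ideal (fun f => exists k l i m,
    f = (formal_mulmx k *m formal_mulmx l - formal_mulmx l *m formal_mulmx k) i m).

End BorderScheme.

(** The pseudo border is [phi(border_term (e j))], [j < alpha]: in the first
    case [e] enumerates the whole border, in the second one it enumerates the
    corners, which always belong to the border. *)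

Record pseudo_order_ideal (K : fieldType) (n mu alpha : nat) :=
    PseudoOrderIdeal {
  poi_phi : lin_change K n;
  poi_o : mu.-tuple 'X_{1..n};
  poi_order_ideal : order_ideal poi_o;
  poi_e : 'I_alpha -> 'I_(size (border poi_o));
  poi_e_inj : injective poi_e;
  poi_case :
    (forall m, m \in border poi_o <-> exists j, m = border_term (poi_e j)) \/
    (exists le, [/\ term_ordering le, cornercut le poi_o &
       forall m, corner poi_o m <-> exists j, m = border_term (poi_e j)])
}.

Section PseudoOrderIdeal.
Variables (K : fieldType) (n mu alpha : nat).
Variable P : pseudo_order_ideal K n mu alpha.
Local Notation o := (poi_o P).
Local Notation nu := (size (border o)).

Definition poi_t (i : 'I_mu) : {mpoly K[n]} := poi_phi P 'X_[tnth o i].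
Definition poi_b (j : 'I_alpha) : {mpoly K[n]} :=
  poi_phi P 'X_[border_term (poi_e P j)].

Local Notation Kc := {mpoly K[mu * alpha]}.

Definition cvar (i : 'I_mu) (j : 'I_alpha) : Kc := 'X_(mxvec_index i j).

(** The embedding [c_ij |-> c_(i, e j)] of polynomial rings; pulling back along
    it is a relabelling of the indeterminates in the first case, and the
    intersection with the polynomial ring in the indeterminates attached to
    corners in the second one. *)
Definition relabel : Kc -> {mpoly K[mu * nu]} :=
  comp_mpoly [tuple mxvec (\matrix_(i < mu, j < alpha)
    ('X_(mxvec_index i (poi_e P j)) : {mpoly K[mu * nu]})) ord0 v | v < mu * alpha].
HB.instance Definition _ := GRing.RMorphism.copy relabel
  (comp_mpoly [tuple mxvec (\matrix_(i < mu, j < alpha)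
    ('X_(mxvec_index i (poi_e P j)) : {mpoly K[mu * nu]})) ord0 v | v < mu * alpha]).

Definition scheme_ideal : ideal Kc := comap_ideal relabel (border_ideal K o).

Definition B_ring : comPzRingType := quot_ring scheme_ideal.

Definition Kc_proj : Kc -> B_ring := qproj scheme_ideal.
HB.instance Definition _ := GRing.RMorphism.copy Kc_proj (qproj scheme_ideal).

(** [K[x_1, ..., x_n, c_ij]] is taken as [K[c_ij][x_1, ..., x_n]]. *)
Definition generic_g (j : 'I_alpha) : {mpoly Kc[n]} :=
  map_mpoly (@mpolyC (mu * alpha) K) (poi_b j) -
  \sum_(i < mu) cvar i j *: map_mpoly (@mpolyC (mu * alpha) K) (poi_t i).

Definition universal_ideal : ideal {mpoly Kc[n]} :=
  gen_ideal (fun f => (exists2 h, scheme_ideal h & f = h%:MP) \/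
                      (exists j, f = generic_g j)).

Definition U_ring : comPzRingType := quot_ring universal_ideal.

Fact universal_ideal_C h : scheme_ideal h -> universal_ideal h%:MP.
Proof. by move=> hh J; apply; left; exists h. Qed.

Definition B_to_U : B_ring -> U_ring :=
  quot_map (@mpolyC n Kc) universal_ideal_C.
HB.instance Definition _ :=
  GRing.RMorphism.copy B_to_U (quot_map (@mpolyC n Kc) universal_ideal_C).

End PseudoOrderIdeal.

Arguments B_to_U {K n mu alpha} P _.

Section CoordinateChanges.
Variables (K : fieldType) (n : nat).

Local Notation Ka := {mpoly K[n * n.+1]}.

Definition gen_mx : 'M[Ka]_(n, n.+1) :=
  \matrix_(i < n, j < n.+1) 'X_(mxvec_index i j).

Definition Delta : Ka := \det (lin_part gen_mx).

Lemma Delta_neq0 : Delta != 0.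
Proof.
pose A : 'M[K]_(n, n.+1) :=
  \matrix_(i < n, j < n.+1) (if unlift ord0 j is Some k then (i == k)%:R else 0).
apply/eqP => D0; have : Delta.@[mxvec A ord0] = 1.
  rewrite /Delta -det_map_mx; have -> : map_mx (meval (mxvec A ord0)) (lin_part gen_mx) = 1%:M.
    by apply/matrixP => i j; rewrite !mxE /= mevalXU mxvecE mxE liftK.
  exact: det1.
by rewrite D0 meval0 => /esym/eqP; rewrite oner_eq0.
Qed.

Definition Ka_Delta : idomainType := loc Delta.

Definition Ka_in : Ka -> Ka_Delta := loc_in Delta.
HB.instance Definition _ := GRing.RMorphism.copy Ka_in (loc_in Delta).

Definition K_in : K -> Ka_Delta := Ka_in \o @mpolyC (n * n.+1) K.
HB.instance Definition _ :=
  GRing.RMorphism.copy K_in (Ka_in \o @mpolyC (n * n.+1) K).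

Definition gen_mxD : 'M[Ka_Delta]_(n, n.+1) := map_mx Ka_in gen_mx.

Lemma lin_part_map (R S : comNzRingType) (f : {rmorphism R -> S})
  (A : 'M[R]_(n, n.+1)) : lin_part (map_mx f A) = map_mx f (lin_part A).
Proof. by apply/matrixP => i j; rewrite !mxE. Qed.

Fact gen_mxD_unit : lin_part gen_mxD \in unitmx.
Proof.
rewrite lin_part_map unitmxE det_map_mx; exact: loc_in_unit Delta_neq0.
Qed.

Definition gen_change : lin_change Ka_Delta n := mx_change gen_mxD_unit.

Section Point.
Variable p : Spec Ka_Delta.

Fact point_mx_unit : lin_part (map_mx (residue p) gen_mxD) \in unitmx.
Proof.
by rewrite lin_part_map unitmxE det_map_mx; apply: rmorph_unit; rewrite -unitmxE gen_mxD_unit.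
Qed.

Definition point_change : lin_change (residue_field p) n :=
  mx_change point_mx_unit.

Definition K_residue : K -> residue_field p := residue p \o K_in.
HB.instance Definition _ := GRing.RMorphism.copy K_residue (residue p \o K_in).

End Point.

(** A point of [Spec (K[a_ij]_Delta)] is determined by its contraction to
    [K[a_ij]]; here this is the kernel of the evaluation at the coefficients of
    [phi]. *)
Definition represents (p : Spec Ka_Delta) (phi : lin_change K n) : Prop :=
  forall f : Ka, p (Ka_in f) <-> f.@[mxvec (lc_mx phi) ord0] = 0.

End CoordinateChanges.

Section OpenSet.
Variables (K : fieldType) (n mu alpha : nat).
Variables (P : pseudo_order_ideal K n mu alpha) (I : ideal {mpoly K[n]}).
Local Notation t := (poi_t P).
Local Notation b := (poi_b P).

Section Extension.
Variables (R : comNzRingType) (f : {rmorphism K -> R}).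
Definition I_ext : ideal {mpoly R[n]} :=
  ext_ideal (map_mpoly f : {mpoly K[n]} -> {mpoly R[n]}) I.
Definition t_ext (i : 'I_mu) : {mpoly R[n]} := map_mpoly f (t i).
Definition b_ext (j : 'I_alpha) : {mpoly R[n]} := map_mpoly f (b j).
End Extension.

Definition W_open : set (Spec (Ka_Delta K n)) :=
  [set p | exists M : 'M[residue_field p]_mu,
     change_mx (I_ext (K_residue p)) (point_change p)
       (t_ext (K_residue p)) (t_ext (K_residue p)) M /\ M \in unitmx].

Definition is_M_gen (M : 'M[Ka_Delta K n]_mu) : Prop :=
  change_mx (I_ext (@K_in K n)) (gen_change K n)
    (t_ext (@K_in K n)) (t_ext (@K_in K n)) M.

Definition is_N_gen (N : 'M[Ka_Delta K n]_(mu, alpha)) : Prop :=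
  change_mx (I_ext (@K_in K n)) (gen_change K n)
    (t_ext (@K_in K n)) (b_ext (@K_in K n)) N.

End OpenSet.

(* Main.v *)
Require Import Defs.
From HB Require Import structures.
From mathcomp Require Import all_boot all_order all_algebra.
From mathcomp Require Import boolp classical_sets.
From mathcomp Require Import ssrcomplements mpoly.

Import GRing.Theory.
Local Open Scope ring_scope.
Local Open Scope classical_set_scope.

(** The proof runs on coordinate maps. That [t] is a basis modulo an ideal [J] of
    [S[x_1, ..., x_n]] is recorded by an [S]-linear map [c] onto [S^mu] which has
    kernel [J] and sends [t_i] to the [i]-th unit vector ([coords]). Over the field
    [K] such a map exists because [P] is a basis modulo [I]. Extending it linearly
    along a ring homomorphism from [K] to [S] gives a coordinate map for the
    extended ideal ([base_coordsP]), so the matrices [M] and [N] exist over every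
    [K]-algebra, they are unique, and they commute with base change
    ([gen_coords_mx_spec]). Hence the matrix attached to a point of the scheme of
    coordinate changes is the specialization of the generic one, and [W] is the
    basic open set on which [Lambda] does not vanish. The identity specializes the
    generic matrix to [1], so [Lambda <> 0] and [W] contains the generic point.

    On the basic open set of a nonzero [f] in an integral domain [D], a section of
    the structure sheaf agrees everywhere with its value at the generic point. This
    value is an element of the fraction field which is regular at all primes
    avoiding [f]. Some power of [f] is then a denominator of it, because the ideal
    of its denominators lies in no prime avoiding [f] ([regular_loc]). This gives
    the coordinate ring [D_f], and homomorphisms into [D_f] induce morphisms
    ([induced_morphism_exists]).

    Let [T] be the coordinate ring of [W]. Over [T] the matrix [M] is invertible, and
    [f |-> M^-1 c(phi^-1 f)] is a coordinate map for the image ideal [J] of [I]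
    ([image_coordsP]); the coordinates of the pseudo border are the columns of
    [M^-1 N]. Multiplication by the indeterminates on [T[x]/J] is described by
    the formal multiplication matrices evaluated at the coordinates of the border.
    These operators commute, so the ideal of the border basis scheme vanishes there
    ([scheme_ideal_eval]). This is the existence of [psi]. The residue map
    of a point of [W] factors through [T], which identifies the image of the point
    ([point_psi]).

    For flatness, every polynomial reduces modulo the relations [g_j] to a
    combination of [P] ([span_pseudo_border]). When only the corners are available,
    the remaining border terms are reduced by induction along the term ordering.
    Thus the elements of [P] generate the [T]-algebra obtained from [U_P] by base
    change, and the coordinate map of [J] is a dual basis for them. A module with a
    finite dual basis is flat ([flat_dual_basis]). *)

Set Implicit Arguments.
Unset Strict Implicit.
Unset Printing Implicit Defensive.

(** * Prime ideals and localization of an integral domain *)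

Lemma ideal_ext (R : comPzRingType) (I J : ideal R) :
  (forall x, I x <-> J x) -> I = J.
Proof.
case: I J => [I ? ? ?] [J ? ? ?] /= IJ.
have E : I = J by apply: funext => x; apply: propext.
by move: E => E; subst J; congr Ideal; apply: Prop_irrelevance.
Qed.

Lemma Spec_ext (R : comPzRingType) (p q : Spec R) :
  (forall x, p x <-> q x) -> p = q.
Proof.
case: p q => [I ? ?] [J ? ?] /= IJ.
have E : I = J by apply: ideal_ext.
by subst J; congr SpecPoint; apply: Prop_irrelevance.
Qed.

Lemma Spec_exp (R : comPzRingType) (p : Spec R) x k : p (x ^+ k) -> p x.
Proof.
elim: k => [|k IH]; first by rewrite expr0 => /Spec_one.
by rewrite exprS => /Spec_prime[].
Qed.

Lemma Spec_Nmul (R : comPzRingType) (p : Spec R) x y : ~ p x -> ~ p y -> ~ p (x * y).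
Proof. by move=> px py /Spec_prime[]. Qed.

Lemma Spec_Nexp (R : comPzRingType) (p : Spec R) x k : ~ p x -> ~ p (x ^+ k).
Proof. by move=> px /Spec_exp. Qed.

Lemma Spec_neq0 (R : comPzRingType) (p : Spec R) x : ~ p x -> x != 0.
Proof. by move=> px; apply/eqP => x0; apply: px; rewrite x0; apply: ideal0. Qed.

Section ZeroIdeal.
Variable R : comPzRingType.

Fact zero_idealD (x y : R) : x = 0 -> y = 0 -> x + y = 0.
Proof. by move=> -> ->; rewrite addr0. Qed.
Fact zero_idealM (a x : R) : x = 0 -> a * x = 0.
Proof. by move=> ->; rewrite mulr0. Qed.

Definition zero_ideal : ideal R :=
  @Ideal R (fun x => x = 0) erefl zero_idealD zero_idealM.

End ZeroIdeal.

Section GenericPoint.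
Variable D : idomainType.

Fact zero_ideal_one : ~ zero_ideal D 1.
Proof. by move=> /eqP; rewrite oner_eq0. Qed.
Fact zero_ideal_prime x y : zero_ideal D (x * y) -> zero_ideal D x \/ zero_ideal D y.
Proof. by move=> /eqP; rewrite mulf_eq0 => /orP[]/eqP; [left|right]. Qed.

Definition generic_point : Spec D := SpecPoint zero_ideal_one zero_ideal_prime.

End GenericPoint.

Section PrimeAvoidance.
Variables (R : comPzRingType) (J : ideal R) (f : R).

Let avoids (A : set R) : Prop :=
  [/\ forall x y, A x -> A y -> A (x + y), forall a x, A x -> A (a * x),
      (forall x, J x -> A x) & forall k, ~ A (f ^+ k)].

(** An ideal that is maximal among those containing [J] and no power of [f] is
    prime: if neither of two elements belongs to it, adjoining either one reaches a
    power of [f], and the product of these two powers has a representation modulo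
    the ideal that only involves the product of the elements. *)
Lemma prime_avoiding : (forall k, ~ J (f ^+ k)) ->
  exists p : Spec R, (forall x, J x -> p x) /\ ~ p f.
Proof.
move=> Jf.
(* The union with [J] makes the union of the empty chain admissible. *)
pose P : set (set R) := [set A | avoids (A `|` (J : set R))].
have [|A [PA Amax]] := @Zorn_bigcup R P.
  move=> F FP Ftot.
  have in2 x y : (\bigcup_(X in F) X `|` (J : set R)) x ->
      (\bigcup_(X in F) X `|` (J : set R)) y ->
      exists B : set R, [/\ avoids (B `|` (J : set R)), (B `|` (J : set R)) x,
        (B `|` (J : set R)) y &
        B `|` (J : set R) `<=` \bigcup_(X in F) X `|` (J : set R)].
    move=> [[X FX Xx]|Jx] [[Y FY Yy]|Jy].
    - have [XY|YX] := Ftot _ _ FX FY.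
        exists Y; split; [exact: FP|by left; apply: XY|by left|].
        by apply: setSU => z ?; exists Y.
      exists X; split; [exact: FP|by left|by left; apply: YX|].
      by apply: setSU => z ?; exists X.
    - exists X; split; [exact: FP|by left|by right|].
      by apply: setSU => z ?; exists X.
    - exists Y; split; [exact: FP|by right|by left|].
      by apply: setSU => z ?; exists Y.
    - exists set0; split; [|by right|by right|by apply: setSU].
      rewrite set0U; split=> // *; [exact: idealD|exact: idealM].
  split=> [x y hx hy|a x hx|x Jx|k hk].
  - by have [B [[BD _ _ _] Bx By sB]] := in2 _ _ hx hy; apply: sB; apply: BD.
  - by have [B [[_ BM _ _] Bx _ sB]] := in2 _ _ hx hx; apply: sB; apply: BM.
  - by right.
  - by have [B [[_ _ _ Bf] Bx _ _]] := in2 _ _ hk hk; apply: (Bf k).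
case: PA => AD AM AJ Af; set M := A `|` _ in AD AM AJ Af.
have M0 : M 0 by apply: AJ; apply: ideal0.
pose I := @Ideal R M M0 AD AM.
have grow x : ~ M x -> exists k a m, M m /\ f ^+ k = m + a * x.
  move=> Mx; apply: contrapT => no.
  apply: (Amax [set z | exists a m, M m /\ z = m + a * x]).
    split=> [z Az|].
      by exists 0, z; split; [left | rewrite mul0r addr0].
    move=> /(_ x) h; apply: Mx; left; apply: h.
    by exists 1, 0; rewrite mul1r add0r.
  have E : [set z | exists a m, M m /\ z = m + a * x] `|` (J : set R)
         = [set z | exists a m, M m /\ z = m + a * x].
    apply/seteqP; split=> z; last by left.
    move=> [//|Jz]; exists 0, z; split; first exact: AJ.
    by rewrite mul0r addr0.
  rewrite /P /= E; split.
  - move=> _ _ [a [m [Mm ->]]] [b [m' [Mm' ->]]]; exists (a + b), (m + m').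
    by split; [exact: (AD) | rewrite mulrDl addrACA].
  - move=> c _ [a [m [Mm ->]]]; exists (c * a), (c * m).
    by split; [exact: (AM) | rewrite mulrDr mulrA].
  - by move=> z /AJ Mz; exists 0, z; rewrite mul0r addr0.
  - by move=> k [a [m Hm]]; apply: no; exists k, a, m.
have I1 : ~ I 1 by rewrite -(expr0 f); apply: (Af).
have Ip x y : I (x * y) -> I x \/ I y.
  move=> Ixy; apply: contrapT => /not_orP[/grow[k [a [m [Mm Ek]]]]].
  move=> /grow[l [b [m' [Mm' El]]]]; apply: (Af (k + l)%N).
  have -> : f ^+ (k + l) = (m' + b * y) * m + (a * x) * m' + (a * b) * (x * y).
    rewrite exprD Ek El mulrDl (mulrC m) -addrA; congr (_ + _).
    by rewrite mulrDr mulrACA.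
  by apply: (AD); [apply: (AD)|]; apply: (AM).
exists (SpecPoint I1 Ip); split=> [x /AJ //|/= Mf]; apply: (Af 1).
by rewrite expr1.
Qed.

End PrimeAvoidance.

Lemma zopen_basic (R : comPzRingType) (f : R) : zopen [set p : Spec R | ~ p f].
Proof.
exists [set f]; apply/seteqP; split=> p /= => [pf|[g -> //]].
by exists f.
Qed.

Section LocLift.
Variables (D : idomainType) (f : D).

(** The condition on [f] is under the existential quantifiers so that the choice of
    a numerator and an exponent does not depend on a proof of it. *)
Lemma loc_fraction (x : loc f) : exists a k, f != 0 ->
  x * loc_in f f ^+ k = loc_in f a.
Proof.
have /loc_predP[a [k xE]] := loc_valP x.
exists a, k => f0; apply: val_inj; rewrite rmorphM rmorphXn /= xE.
by rewrite divfK // expf_neq0 // tofrac_eq0.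
Qed.

Definition loc_num (x : loc f) : D := projT1 (cid (loc_fraction x)).
Definition loc_exp (x : loc f) : nat := projT1 (cid (projT2 (cid (loc_fraction x)))).

Hypothesis f0 : f != 0.

Lemma loc_numE x : x * loc_in f f ^+ loc_exp x = loc_in f (loc_num x).
Proof. exact: (projT2 (cid (projT2 (cid (loc_fraction x))))). Qed.

Lemma loc_valE x : loc_val x = tofrac (loc_num x) / tofrac f ^+ loc_exp x.
Proof.
have := congr1 (@loc_val _ _) (loc_numE x); rewrite (rmorphM (@loc_val _ _)) (rmorphXn (@loc_val _ _)) /=.
by move=> <-; rewrite mulfK // expf_neq0 // tofrac_eq0.
Qed.

Lemma loc_in_inj : injective (loc_in f).
Proof. by move=> a b /(congr1 (@loc_val _ _)) /= /eqP; rewrite tofrac_eq => /eqP. Qed.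

Variables (F : comUnitRingType) (g : {rmorphism D -> F}).
Hypothesis gf : g f \is a GRing.unit.

(** The two proofs are arguments because the instances of a ring homomorphism
    declared below have to recover them from the term. *)
Definition loc_lift (_ : f != 0) (_ : g f \is a GRing.unit) (x : loc f) : F :=
  g (loc_num x) / g f ^+ loc_exp x.
Local Notation lift := (loc_lift f0 gf).

Lemma loc_liftP x a k : x * loc_in f f ^+ k = loc_in f a -> lift x = g a / g f ^+ k.
Proof.
move=> xE; apply: (canRL (mulrK (unitrX k gf))).
rewrite /loc_lift mulrAC; apply: (canLR (mulrK (unitrX _ gf))).
rewrite -!rmorphXn -!rmorphM; congr (g _); apply: loc_in_inj.
by rewrite !rmorphM !rmorphXn /= -loc_numE -xE mulrAC.
Qed.

Lemma loc_liftE a : lift (loc_in f a) = g a.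
Proof. by rewrite (@loc_liftP _ a 0) ?expr0 ?mulr1 ?divr1. Qed.

Fact loc_lift_zmod : zmod_morphism lift.
Proof.
move=> x y.
rewrite (@loc_liftP _ (loc_num x * f ^+ loc_exp y - loc_num y * f ^+ loc_exp x)
   (loc_exp x + loc_exp y)).
  rewrite /loc_lift exprD invrM ?unitrX // rmorphB !rmorphM !rmorphXn mulrBl.
  congr (_ - _); first by rewrite mulrA mulrK ?unitrX.
  by rewrite (mulrC (_ ^- _)) mulrA mulrK ?unitrX.
rewrite rmorphB !rmorphM !rmorphXn /= -!loc_numE exprD mulrBl; congr (_ - _).
  by rewrite mulrA.
by rewrite (mulrC (_ ^+ loc_exp x)) mulrA.
Qed.

Fact loc_lift_monoid : monoid_morphism lift.
Proof.
split; first by rewrite -(rmorph1 (loc_in f)) loc_liftE rmorph1.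
move=> x y; rewrite (@loc_liftP _ (loc_num x * loc_num y) (loc_exp x + loc_exp y)).
  by rewrite /loc_lift exprD invrM ?unitrX // rmorphM (mulrC (_ ^- _)) mulrACA.
by rewrite rmorphM /= -!loc_numE exprD mulrACA.
Qed.

HB.instance Definition _ := GRing.isZmodMorphism.Build (loc f) F lift loc_lift_zmod.
HB.instance Definition _ := GRing.isMonoidMorphism.Build (loc f) F lift loc_lift_monoid.

End LocLift.

Section LocKernel.
Variables (D : idomainType) (f : D) (F : fieldType) (r : {rmorphism loc f -> F}).
Variable p : Spec D.
Hypotheses (f0 : f != 0) (rp : forall a, p a <-> r (loc_in f a) = 0).

Lemma loc_kernel_unit : ~ p f.
Proof.
move=> /rp rf; have := rmorph_unit r (loc_in_unit f0).
by rewrite rf unitr0.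
Qed.

(** This turns the description of the image of a point through the maximal ideal of
    a local ring of [D] into a condition over a residue field. *)
Lemma loc_kernel (y : loc f) :
  r y = 0 <-> exists x : D * D, [/\ p x.1, ~ p x.2 & loc_val y = Defs.frac x].
Proof.
split=> [ry|[[a b] /= [pa pb]]].
  exists (loc_num y, f ^+ loc_exp y); split.
  - by apply/rp; rewrite -loc_numE // rmorphM ry mul0r.
  - exact/Spec_Nexp/loc_kernel_unit.
  - by rewrite loc_valE // /Defs.frac /= rmorphXn.
have b0 := Spec_neq0 pb.
rewrite /Defs.frac /= => yE; have yb : y * loc_in f b = loc_in f a.
  by apply: val_inj; rewrite rmorphM /= yE divfK // tofrac_eq0.
move/rp: pa; rewrite -yb rmorphM => /eqP; rewrite mulf_eq0 => /orP[/eqP //|/eqP].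
by move/rp.
Qed.

End LocKernel.

(** * Basic open subsets of an integral affine scheme *)

Section BasicOpen.
Variables (D : idomainType) (f : D).
Hypothesis f0 : f != 0.
Local Notation W := [set p : Spec D | ~ p f].

Local Notation generic := (generic_point D).

Lemma frac_eq (x y : D * D) : x.2 != 0 -> y.2 != 0 ->
  Defs.frac x = Defs.frac y <-> x.1 * y.2 - y.1 * x.2 = 0.
Proof.
move=> x0 y0; rewrite /Defs.frac; split=> /eqP.
  rewrite eqr_div ?tofrac_eq0 // -!rmorphM tofrac_eq => /eqP ->.
  by rewrite subrr.
rewrite subr_eq0 => /eqP E.
by apply/eqP; rewrite eqr_div ?tofrac_eq0 // -!rmorphM tofrac_eq E.
Qed.

Lemma same_germ_frac (p : Spec D) x y : ~ p x.2 -> ~ p y.2 ->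
  same_germ p x y -> Defs.frac x = Defs.frac y.
Proof.
move=> /Spec_neq0 x0 /Spec_neq0 y0 [t /Spec_neq0 t0 /eqP].
by rewrite mulf_eq0 (negPf t0) => /eqP/frac_eq; apply.
Qed.

(** Every nonempty open set contains the generic point, so each local expression of
    a section can be compared with its value there. *)
Lemma section_frac (U : set (Spec D)) s (p q : Spec D) : is_section U s -> U p -> U q ->
  Defs.frac (s p) = Defs.frac (s q).
Proof.
move=> [s2 sloc].
suff gen r : U r -> U generic /\ Defs.frac (s r) = Defs.frac (s generic).
  by move=> /gen[_ ->] /gen[_ ->].
move=> Ur; have [V [[E VE] Vr VU [x xV]]] := sloc r Ur.
have Vg : V generic.
  by move: Vr; rewrite VE /= => -[g Eg /Spec_neq0 /eqP g0]; exists g.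
split; first exact: VU.
have [? ?] := xV _ Vr; have [? ?] := xV _ Vg.
rewrite (@same_germ_frac r (s r) x) //; last exact: s2.
by rewrite (@same_germ_frac generic (s generic) x) //; apply: s2; apply: VU.
Qed.

Section Denominators.
Variable y : {fraction D}.
Let den (d : D) : Prop := exists a, y * tofrac d = tofrac a.
Fact den0 : den 0. Proof. by exists 0; rewrite rmorph0 mulr0. Qed.
Fact denD d e : den d -> den e -> den (d + e).
Proof. by move=> [a da] [b eb]; exists (a + b); rewrite !rmorphD mulrDr da eb. Qed.
Fact denM c d : den d -> den (c * d).
Proof. by move=> [a da]; exists (c * a); rewrite !rmorphM mulrCA da. Qed.
Definition denominators : ideal D := Ideal den0 denD denM.
End Denominators.

(** An element of the fraction field that is regular at every prime of the basic
    open set has a power of [f] as a denominator: otherwise some prime avoiding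
    [f] would contain all its denominators. *)
Lemma regular_loc (y : {fraction D}) :
  (forall p : Spec D, ~ p f -> exists x : D * D, ~ p x.2 /\ y = Defs.frac x) ->
  y \in loc_pred f.
Proof.
move=> reg; have [[k [a ya]]|no] := pselect (exists k, denominators y (f ^+ k)).
  apply/loc_predP; exists a, k; rewrite -ya rmorphXn mulfK //.
  by rewrite expf_neq0 // tofrac_eq0.
have [|p [dp pf]] := @prime_avoiding D (denominators y) f.
  by move=> k hk; apply: no; exists k.
have [[a b] /= [pb yE]] := reg p pf.
case: pb; apply: dp; exists a; rewrite yE /Defs.frac /= divfK // tofrac_eq0.
apply/eqP=> b0; have := reg generic; case=> [/=|[c d] /= [d0 yE']].
  by apply/eqP.
move: yE; rewrite /Defs.frac /= b0 rmorph0 invr0 mulr0 => y0.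
by case: no; exists 0; exists 0; rewrite expr0 rmorph1 y0 mul0r rmorph0.
Qed.

(** The prime of the localization over [p] is the kernel of the residue map of [p]
    extended to the fractions with denominator a power of [f]. *)
Lemma point_loc_kernel (p : Spec D) (pf : ~ p f) :
  exists q : Spec (loc f), Spec_map (loc_in f) q = p.
Proof.
have gf : residue p f \is a GRing.unit.
  by rewrite unitfE; apply/eqP => /residue_eq0.
exists (Spec_map (loc_lift f0 gf) (generic_point _)); apply: Spec_ext => a /=.
by rewrite loc_liftE residue_eq0.
Qed.

(** The primes of [D_f] are determined by the numerators that they contain, since
    [f] is a unit; this gives injectivity and the comparison of the topologies. *)
Lemma basic_open_coordinate_ring : has_coordinate_ring W f.
Proof.
split.
- move=> x; exists (fun=> (loc_num x, f ^+ loc_exp x)); split; last first.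
    by move=> p _; rewrite /Defs.frac /= rmorphXn -loc_valE.
  split=> [p /= pf|p pf]; first exact: Spec_Nexp.
  exists W; split=> //; first exact: zopen_basic.
  exists (loc_num x, f ^+ loc_exp x) => q qf; split; first exact: Spec_Nexp.
  by exists 1; [exact: Spec_one | rewrite subrr mulr0].
- move=> s sP; have Wg : W generic by apply/eqP.
  have yP : Defs.frac (s generic) \in loc_pred f.
    apply: regular_loc => p pf; exists (s p); split; first by case: sP => + _; apply.
    exact: section_frac sP _ _.
  exists (Loc yP); split=> [p Wp|x xs]; first exact: section_frac sP _ _.
  by apply: val_inj; rewrite /= -(xs generic).
split.
- move=> q q' /(congr1 (fun p : Spec D => p : D -> Prop)) /= E; apply: Spec_ext => x.
  have half (q1 q2 : Spec (loc f)) :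
      (forall a, q1 (loc_in f a) -> q2 (loc_in f a)) -> q1 x -> q2 x.
    move=> h q1x; have : q2 (x * loc_in f f ^+ loc_exp x).
      by rewrite loc_numE //; apply: h; rewrite -loc_numE // mulrC; apply: idealM.
    case/Spec_prime => // /Spec_exp q2f; case: (@Spec_one _ q2).
    by rewrite -(mulVr (loc_in_unit f0)); apply: idealM.
  split; apply: half => a.
    by have := congr1 (@^~ a) E => /= ->.
  by have := congr1 (@^~ a) E => /= ->.
- apply/seteqP; split=> p; last by move=> /point_loc_kernel[q <-]; exists q.
  move=> [q _ <-] /= qf; apply: (@Spec_one _ q).
  by rewrite -(mulVr (loc_in_unit f0)); apply: idealM.
have unit_notin (q : Spec (loc f)) : ~ q (loc_in f f).
  move=> qf; apply: (@Spec_one _ q).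
  by rewrite -(mulVr (loc_in_unit f0)); apply: idealM.
have num_in (q : Spec (loc f)) x : q (loc_in f (loc_num x)) <-> q x.
  rewrite -loc_numE //; split=> [/Spec_prime[//|/Spec_exp/unit_notin //]|qx].
  by rewrite mulrC; apply: idealM.
move=> V; split=> -[E VE].
  exists [set f * loc_num x | x in E]; apply/seteqP; split=> p /=.
    move=> [q]; rewrite VE /= => -[x Ex qx] <-; exists (f * loc_num x); first by exists x.
    by rewrite /= rmorphM => /Spec_prime[/unit_notin //|/num_in].
  move=> [_ [x Ex <-] pfx].
  have pf : ~ p f by move=> h; apply: pfx; rewrite mulrC; apply: idealM.
  have [q qp] := point_loc_kernel pf; exists q => //; rewrite VE; exists x => //.
  by move=> /num_in; rewrite -[q _]/(Spec_map (loc_in f) q _) qp => h; apply/pfx/idealM.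
exists [set loc_in f a | a in E]; apply/seteqP; split=> q /=.
  move=> Vq; have : [set p : Spec D | exists2 a, E a & ~ p a] (Spec_map (loc_in f) q).
    by rewrite -VE; exists q.
  by move=> [a Ea qa]; exists (loc_in f a) => //; exists a.
move=> [_ [a Ea <-] qa].
have : (Spec_map (loc_in f) @` V) (Spec_map (loc_in f) q) by rewrite VE; exists a.
move=> [q' Vq' /(congr1 (fun p : Spec D => p : D -> Prop)) /= Eq].
suff -> : q = q' by [].
apply: Spec_ext => x; rewrite -num_in -[X in _ <-> X]num_in.
by have := congr1 (@^~ (loc_num x)) Eq => /= ->.
Qed.

Section InducedMorphism.
Variables (B : comPzRingType) (psi : {rmorphism B -> loc f}).

(** A point of the basic open set is the contraction of a prime of [D_f], which is
    pulled back along [psi]. Writing the values of [psi] as fractions with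
    denominators powers of [f] turns local fractions over [B] into local fractions
    over [D]. *)
Lemma induced_morphism_exists :
  exists Phi, induced_morphism W (fun b => loc_val (psi b)) Phi.
Proof.
have Wg : W generic by apply/eqP.
have /choice[pre preP] : forall p : Spec D, exists q : Spec (loc f),
    ~ p f -> Spec_map (loc_in f) q = p.
  move=> p; have [/point_loc_kernel[q qp]|pf] := pselect (~ p f); first by exists q.
  by have [q _] := point_loc_kernel Wg; exists q.
pose Phi p := Spec_map psi (pre p).
have preE (p : Spec D) : ~ p f -> forall a, p a <-> pre p (loc_in f a).
  by move=> pf a; move: (preP _ pf); move: (pre p) => q <-.
have num_in (p : Spec D) : ~ p f -> forall x, p (loc_num x) <-> pre p x.
  move=> pf x; rewrite preE // -loc_numE //.
  split=> [/Spec_prime[//|/Spec_exp/preE //]|h]; last by rewrite mulrC; apply: idealM.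
  by move=> h; case: (pf); apply: h.
have fracE (x : loc f) : loc_val x = Defs.frac (loc_num x, f ^+ loc_exp x).
  by rewrite loc_valE // /Defs.frac /= rmorphXn.
have pull V : zopen V -> zopen (W `&` Phi @^-1` V).
  move=> [E ->]; exists [set f * loc_num (psi b) | b in E].
  apply/seteqP; split=> p /=.
    move=> [pf [b Eb pb]]; exists (f * loc_num (psi b)); first by exists b.
    by apply: Spec_Nmul => // /num_in -/(_ pf).
  move=> [_ [b Eb <-] h].
  have pf : ~ p f by move=> pf; apply: h; rewrite mulrC; apply: idealM.
  by split=> //; exists b => // hb; apply: h; apply: idealM; apply/num_in.
exists Phi; split=> // [p pf b|V s Vo [s2 sloc]].
  split=> [pb|[[a c] /= [pa pc yE]]].
    exists (loc_num (psi b), f ^+ loc_exp (psi b)); split=> //.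
      exact/num_in.
    exact: Spec_Nexp.
  have c0 := Spec_neq0 pc.
  have : psi b * loc_in f c = loc_in f a.
    by apply: val_inj; rewrite rmorphM /= yE /Defs.frac /= divfK // tofrac_eq0.
  move=> E; have : pre p (psi b * loc_in f c) by rewrite E -preE.
  by case/Spec_prime => // /preE -/(_ pf).
(* The numerator and the denominator of [psi x.1 / psi x.2]. *)
pose tr (x : B * B) : D * D :=
  (loc_num (psi x.1) * f ^+ loc_exp (psi x.2), loc_num (psi x.2) * f ^+ loc_exp (psi x.1)).
have trE x : Defs.frac (tr x) = loc_val (psi x.1) / loc_val (psi x.2).
  rewrite /Defs.frac /= !loc_valE // !rmorphM !rmorphXn invfM invf_div.
  by rewrite /= [RHS]mulrACA (mulrC (tofrac (loc_num (psi x.2)))^-1).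
have tr2 (p : Spec D) x : ~ p f -> ~ Phi p x.2 -> ~ p (tr x).2.
  move=> pf px; apply: Spec_Nmul; last exact: Spec_Nexp.
  by move=> /num_in -/(_ pf).
exists (fun p => tr (s (Phi p))); split; last by move=> p _; apply: trE.
split=> [p [pf Vp]|p [pf Vp]]; first by apply: tr2 => //; apply: s2.
have [V' [V'o V'p V'V [x xP]]] := sloc _ Vp.
exists (W `&` Phi @^-1` V'); split=> //; first exact: pull.
  by move=> q [qf V'q]; split=> //; apply: V'V.
exists (tr x) => q [qf V'q]; have [qx [t qt tE]] := xP _ V'q.
have Vq := V'V _ V'q; split; first exact: tr2.
exists 1; first exact: Spec_one.
rewrite mul1r; apply/frac_eq.
- by apply: (@Spec_neq0 _ q); apply: tr2 => //; apply: s2.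
- by apply: (@Spec_neq0 _ q); apply: tr2.
rewrite !trE.
have nz b : ~ Phi q b -> loc_val (psi b) != 0.
  by move=> /(@Spec_neq0 _ (pre q)); rewrite -(inj_eq val_inj).
apply/eqP; rewrite eqr_div ?nz //; last exact: s2.
rewrite -subr_eq0 -!(rmorphM (@loc_val _ _)) -(rmorphB (@loc_val _ _)) -!(rmorphM psi) -(rmorphB psi) /=.
have /(congr1 (@loc_val _ _ \o psi)) /= := tE; rewrite rmorphM rmorph0 (rmorphM (@loc_val _ _)).
rewrite (rmorph0 (@loc_val _ _)) => /eqP.
by rewrite mulf_eq0 (negPf (nz _ qt)).
Qed.

End InducedMorphism.
End BasicOpen.

Section QuotLift.
Variables (R S : comPzRingType) (I : ideal R) (h : {rmorphism R -> S}).
Hypothesis hI : forall x, I x -> h x = 0.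

(** The proof is an argument for the same reason as in [loc_lift]. *)
Definition quot_lift (_ : forall x, I x -> h x = 0) (u : quot_ring I) : S := h (repr u).
Local Notation ql := (quot_lift hI).

Lemma quot_liftE x : ql (qproj I x) = h x.
Proof.
apply/eqP; rewrite -subr_eq0 -rmorphB; apply/eqP/hI/qproj_eq.
by rewrite /qproj generic_quotient.reprK.
Qed.

Fact quot_lift_zmod : zmod_morphism ql.
Proof.
move=> u v; case: (qproj_surj u) (qproj_surj v) => x -> [y ->].
by rewrite -raddfB !quot_liftE raddfB.
Qed.

Fact quot_lift_monoid : monoid_morphism ql.
Proof.
split=> [|u v]; first by rewrite -[1](rmorph1 (qproj I)) quot_liftE rmorph1.
case: (qproj_surj u) (qproj_surj v) => x -> [y ->].
by rewrite -rmorphM !quot_liftE rmorphM.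
Qed.

HB.instance Definition _ := GRing.isZmodMorphism.Build (quot_ring I) S ql quot_lift_zmod.
HB.instance Definition _ :=
  GRing.isMonoidMorphism.Build (quot_ring I) S ql quot_lift_monoid.

End QuotLift.

(** * Coordinates modulo an ideal *)

Lemma mpoly_rmorph_ext (R : comNzRingType) (T : comPzRingType) (n : nat)
    (g h : {rmorphism {mpoly R[n]} -> T}) :
  (forall a, g a%:MP = h a%:MP) -> (forall i, g 'X_i = h 'X_i) -> g =1 h.
Proof.
move=> gC gX p; rewrite (mpolyE p) !rmorph_sum; apply: eq_bigr => m _ /=.
rewrite -mul_mpolyC !rmorphM gC mpolyXE_id !rmorph_prod; congr (_ * _).
by apply: eq_bigr => i _; rewrite !rmorphXn /= gX.
Qed.

HB.instance Definition _ (R : comNzRingType) n (phi : lin_change R n) :=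
  GRing.isLinear.Build R {mpoly R[n]} {mpoly R[n]} _ (lc_inv phi)
    (can2_linear (lc_funK phi) (lc_invK phi)).

Section Coordinates.
Variables (S : comNzRingType) (n mu : nat).
Implicit Types (J : ideal {mpoly S[n]}) (t : 'I_mu -> {mpoly S[n]}).
Implicit Type c : {linear {mpoly S[n]} -> 'cV[S]_mu}.

(** This encodes that [t] is a basis modulo [J]: membership in [J] becomes an
    equation between vectors, which can be transported along ring homomorphisms. *)
Definition coords J t c : Prop :=
  (forall f, J f <-> c f = 0) /\ (forall i, c (t i) = delta_mx i 0).

Variables (J : ideal {mpoly S[n]}) (t : 'I_mu -> {mpoly S[n]}).
Variable c : {linear {mpoly S[n]} -> 'cV[S]_mu}.
Hypothesis cP : coords J t c.

Lemma coords_sum (a : 'I_mu -> S) : c (\sum_i a i *: t i) = \col_i a i.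
Proof.
rewrite linear_sum; apply/colP => i; rewrite summxE mxE (bigD1 i) //= linearZ /=.
rewrite cP.2 !mxE !eqxx mulr1 big1 ?addr0 // => j ji.
by rewrite linearZ /= cP.2 !mxE eq_sym (negPf ji) mulr0.
Qed.

Lemma coords_red f : J (f - \sum_i c f i 0 *: t i).
Proof.
apply/cP.1; rewrite linearB /= coords_sum; apply/eqP; rewrite subr_eq0.
by apply/eqP/colP => i; rewrite mxE.
Qed.

Lemma coords_basis : basis_mod J t.
Proof.
split=> [f|a /cP.1]; first by exists (fun i => c f i 0); apply: coords_red.
by rewrite coords_sum => /colP a0 i; have := a0 i; rewrite !mxE.
Qed.

Lemma congr_coords m (u : 'I_m -> {mpoly S[n]}) (N : 'M[S]_(mu, m)) :
  congr_mod J u t N <-> N = \matrix_(i, j) c (u j) i 0.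
Proof.
have E j : c (u j - \sum_i N i j *: t i) = c (u j) - \col_i N i j.
  by rewrite linearB /= coords_sum.
split=> [h|-> j]; last first.
  by apply/cP.1; rewrite linearB /= coords_sum; apply/colP => i; rewrite !mxE subrr.
apply/matrixP => i j; have /cP.1 := h j; rewrite E mxE => /eqP.
by rewrite subr_eq0 => /eqP ->; rewrite mxE.
Qed.

Lemma change_coords m (phi : lin_change S n) (u : 'I_m -> {mpoly S[n]}) (N : 'M[S]_(mu, m)) :
  change_mx J phi t u N <-> N = \matrix_(i, j) c (lc_inv phi (u j)) i 0.
Proof. exact: congr_coords. Qed.

Lemma coords_mull f g : c (f * g) = c ((\sum_i c f i 0 *: t i) * g).
Proof.
apply/eqP; rewrite -subr_eq0 -linearB -mulrBl mulrC; apply/eqP/cP.1.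
exact/idealM/coords_red.
Qed.

End Coordinates.

Section ImageCoordinates.
Variables (S : comUnitRingType) (n mu : nat) (J : ideal {mpoly S[n]}).
Variables (t : 'I_mu -> {mpoly S[n]}) (c : {linear {mpoly S[n]} -> 'cV[S]_mu}).
Hypothesis cP : coords J t c.
Variables (phi : lin_change S n) (M : 'M[S]_mu).

Definition image_coords (f : {mpoly S[n]}) : 'cV[S]_mu :=
  invmx M *m c (lc_inv phi f).

Fact image_coords_linear : linear image_coords.
Proof.
by move=> a f g; rewrite /image_coords !linearP.
Qed.
HB.instance Definition _ :=
  GRing.isLinear.Build S {mpoly S[n]} 'cV[S]_mu _ image_coords image_coords_linear.

Hypotheses (uM : M \in unitmx) (MP : change_mx J phi t t M).

(** The columns of [M] are the coordinates of the [phi^-1 (t_i)], so [M^-1] corrects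
    the map [f |-> c (phi^-1 f)], whose kernel is the image ideal, to the right
    values on [t]. *)
Lemma image_coordsP : coords (image_ideal phi J) t image_coords.
Proof.
split=> [f|i].
  rewrite /= /image_coords; split=> [[g /cP.1 cg ->]|h].
    by rewrite lc_funK cg mulmx0.
  exists (lc_inv phi f); last by rewrite lc_invK.
  by apply/cP.1; rewrite -[c _]mul1mx -(mulmxV uM) -mulmxA h mulmx0.
rewrite /=; have -> : image_coords (t i) = invmx M *m col i M.
  rewrite /image_coords; congr (_ *m _); apply/colP => k.
  by rewrite ((change_coords cP _ _ _).1 MP) !mxE.
by rewrite colE mulmxA mulVmx // mul1mx.
Qed.

Lemma image_coords_congr m (u : 'I_m -> {mpoly S[n]}) (N : 'M[S]_(mu, m)) :
  change_mx J phi t u N -> congr_mod (image_ideal phi J) u t (invmx M *m N).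
Proof.
move=> /(change_coords cP) ->; apply/(congr_coords image_coordsP).
apply/matrixP => i j; rewrite /= !mxE; apply: eq_bigr => k _.
by rewrite !mxE.
Qed.

End ImageCoordinates.

(** * Base change of coordinates *)

Section Naturality.
Variables (S S' : comNzRingType) (n mu : nat) (r : {rmorphism S -> S'}).
Variables (c : {linear {mpoly S[n]} -> 'cV[S]_mu}).
Variables (c' : {linear {mpoly S'[n]} -> 'cV[S']_mu}).
Hypothesis cX : forall m, c' 'X_[m] = map_mx r (c 'X_[m]).

Lemma coords_natural f : c' (map_mpoly r f) = map_mx r (c f).
Proof.
rewrite [in LHS](mpolyE f) [in RHS](mpolyE f) [map_mpoly r _](raddf_sum (map_mpoly r)).
rewrite !linear_sum [map_mx r _](raddf_sum (map_mx r)) /=; apply: eq_bigr => m _.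
by rewrite map_mpolyZ map_mpolyX !linearZ /= map_mxZ cX.
Qed.

End Naturality.

Section BaseChange.
Variables (K S : comNzRingType) (n mu : nat) (f : {rmorphism K -> S}).
Variables (c : {linear {mpoly K[n]} -> 'cV[K]_mu}).

(** The linear extension to [S[x]] of the values of [c] on the terms. *)
Definition base_coords (g : {mpoly S[n]}) : 'cV[S]_mu :=
  \sum_(m <- msupp g) g@_m *: map_mx f (c 'X_[m]).

Lemma base_coordsE k g : (msize g <= k)%N ->
  base_coords g = \sum_(m : 'X_{1..n < k}) g@_m *: map_mx f (c 'X_[m]).
Proof.
move=> gk; rewrite /base_coords (big_mksub 'X_{1..n < k}) ?msupp_uniq //=.
  by rewrite big_rmcond //= => m /memN_msupp_eq0 ->; rewrite scale0r.
by move=> x /msize_mdeg_lt /leq_trans; apply.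
Qed.

Fact base_coords_linear : linear base_coords.
Proof.
move=> a g h; pose k := maxn (msize (a *: g + h)) (maxn (msize g) (msize h)).
rewrite !(@base_coordsE k) ?leq_max ?leqnn ?orbT //.
rewrite scaler_sumr -big_split /=; apply: eq_bigr => m _.
by rewrite mcoeffD mcoeffZ scalerDl scalerA.
Qed.
HB.instance Definition _ :=
  GRing.isLinear.Build S {mpoly S[n]} 'cV[S]_mu _ base_coords base_coords_linear.

Lemma base_coordsX m : base_coords 'X_[m] = map_mx f (c 'X_[m]).
Proof. by rewrite /base_coords msuppX big_seq1 mcoeffX eqxx scale1r. Qed.

Lemma base_coords_map g : base_coords (map_mpoly f g) = map_mx f (c g).
Proof. by apply: (coords_natural (c' := base_coords)) => m; rewrite /= base_coordsX. Qed.

Variables (I : ideal {mpoly K[n]}) (t : 'I_mu -> {mpoly K[n]}).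
Hypothesis cP : coords I t c.

(** The kernel contains the extended ideal because [c] vanishes on the products of
    terms with elements of [I]. Conversely each term is congruent to its reduction
    modulo the extended ideal, hence so is every polynomial. *)
Lemma base_coordsP :
  coords (ext_ideal (map_mpoly f : {mpoly K[n]} -> {mpoly S[n]}) I)
         (fun i => map_mpoly f (t i)) base_coords.
Proof.
have delta i : base_coords (map_mpoly f (t i)) = delta_mx i 0.
  by rewrite base_coords_map cP.2 map_delta_mx.
split=> // g; split=> [|cg J EJ].
  pose vanish (g : {mpoly S[n]}) := forall h, base_coords (h * g) = 0.
  have v0 : vanish 0 by move=> h; rewrite mulr0 linear0.
  have vD x y : vanish x -> vanish y -> vanish (x + y).
    by move=> hx hy h; rewrite mulrDr linearD /= hx hy addr0.
  have vM a x : vanish x -> vanish (a * x) by move=> hx h; rewrite mulrA.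
  move=> /(_ (Ideal v0 vD vM)) /(_ _ 1) /=; rewrite mul1r; apply=> _ [x Ix ->] h.
  rewrite (mpolyE h) mulr_suml linear_sum big1 //= => m _.
  rewrite -scalerAl linearZ /= -(map_mpolyX f) -rmorphM base_coords_map.
  by rewrite ((cP.1 _).1 (idealM _ Ix)) map_mx0 scaler0.
have mon m : J ('X_[m] - \sum_i base_coords 'X_[m] i 0 *: map_mpoly f (t i)).
  apply: EJ; exists ('X_[m] - \sum_i c 'X_[m] i 0 *: t i); first exact: coords_red.
  rewrite rmorphB /= map_mpolyX rmorph_sum; congr (_ - _); apply: eq_bigr => i _.
  by rewrite /= map_mpolyZ base_coordsX mxE.
have <- : g - \sum_i base_coords g i 0 *: map_mpoly f (t i) = g.
  by rewrite cg big1 ?subr0 // => i _; rewrite mxE scale0r.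
have -> : g - \sum_i base_coords g i 0 *: map_mpoly f (t i) =
    \sum_(m <- msupp g) g@_m *: ('X_[m] - \sum_i base_coords 'X_[m] i 0 *: map_mpoly f (t i)).
  under [RHS]eq_bigr => m _ do rewrite scalerBr.
  rewrite sumrB -mpolyE; congr (_ - _).
  under [RHS]eq_bigr => m _ do rewrite scaler_sumr.
  rewrite exchange_big /=; apply: eq_bigr => i _.
  rewrite /base_coords summxE scaler_suml; apply: eq_bigr => m _.
  by rewrite mxE -/(base_coords _) base_coordsX scalerA.
apply: (big_ind J); [exact: ideal0 | exact: idealD | move=> m _].
by rewrite -mul_mpolyC; apply: idealM.
Qed.

End BaseChange.

Lemma basis_coords (K : fieldType) n mu (I : ideal {mpoly K[n]})
    (t : 'I_mu -> {mpoly K[n]}) :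
  basis_mod I t -> exists c : {linear {mpoly K[n]} -> 'cV[K]_mu}, coords I t c.
Proof.
move=> [span free].
have /choice[a aP] := span.
pose c f : 'cV[K]_mu := \col_i a f i.
have uniq f (b : 'cV[K]_mu) : I (f - \sum_i b i 0 *: t i) -> c f = b.
  move=> h; apply/colP => i; apply/eqP; rewrite mxE -subr_eq0; apply/eqP; move: i.
  apply: free; have -> : \sum_i (a f i - b i 0) *: t i =
      (f - \sum_i b i 0 *: t i) + - (f - \sum_i a f i *: t i).
    rewrite opprB addrC addrA subrK -sumrB.
    by apply: eq_bigr => i _; rewrite scalerBl.
  by apply: idealD => //; apply: idealN.
have lin : linear c.
  move=> k f g; apply: uniq.
  have -> : k *: f + g - \sum_i (k *: c f + c g) i 0 *: t i =
      k%:MP * (f - \sum_i a f i *: t i) + (g - \sum_i a g i *: t i).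
    rewrite mul_mpolyC scalerBr addrACA -opprD; congr (_ - _).
    rewrite scaler_sumr -big_split; apply: eq_bigr => i _.
    by rewrite !mxE scalerDl scalerA.
  by apply: idealD => //; apply: idealM.
pose cL := GRing.isLinear.Build K {mpoly K[n]} 'cV[K]_mu _ c lin.
pose cH : {linear {mpoly K[n]} -> 'cV[K]_mu} := HB.pack c cL.
exists cH; split=> [f|i] /=.
  split=> [If|cf]; first by apply: uniq; rewrite big1 ?subr0 // => i _; rewrite mxE scale0r.
  have := aP f; rewrite big1 ?subr0 // => i _.
  by have /colP/(_ i) := cf; rewrite !mxE => ->; rewrite scale0r.
apply: uniq; rewrite (bigD1 i) //= big1 => [|j ji].
  by rewrite mxE !eqxx scale1r addr0 subrr; apply: ideal0.
by rewrite mxE (negPf ji) scale0r.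
Qed.

(** * Linear changes of coordinates as affine matrices *)

Lemma msize2_affine (R : comNzRingType) n (p : {mpoly R[n]}) : (msize p <= 2)%N ->
  p = (p@_0)%:MP + \sum_(j < n) p@_(U_(j)) *: 'X_j.
Proof.
move=> p2; apply/mpolyP => m; rewrite mcoeffD mcoeffC raddf_sum /=.
under eq_bigr => j _ do rewrite mcoeffZ mcoeffX.
have [->|m0] := eqVneq m 0%MM.
  rewrite mulr1 big1 ?addr0 // => j _.
  by rewrite mnm1_eq0 mulr0.
rewrite mulr0 add0r.
have [/mdeg1P[i /eqP ->]|m1] := boolP (mdeg m == 1%N).
  rewrite (bigD1 i) //= eqxx mulr1 big1 ?addr0 // => j ji.
  by rewrite eq_mnm1 (negPf ji) mulr0.
rewrite big1 => [|j _].
  apply/memN_msupp_eq0/msize_mdeg_ge/(leq_trans p2).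
  by case: (mdeg m) (mdeg_eq0 m) m1 => [|[|]] //; rewrite (negPf m0).
case: eqP => [jm|_]; last by rewrite mulr0.
by rewrite -jm mdeg1 in m1.
Qed.

Section LinSubst.
Variables (R : comUnitRingType) (n : nat).

Lemma lin_change_subst (phi : lin_change R n) : phi =1 lin_subst (lc_mx phi).
Proof.
apply: mpoly_rmorph_ext => [a|i].
  by rewrite -[a%:MP]mulr1 mul_mpolyC /= !linearZ !rmorph1.
rewrite /= lin_substX /affine_form {1}(msize2_affine (lc_linear phi i)).
rewrite mxE unlift_none; congr (_ + _); apply: eq_bigr => j _.
by rewrite mxE liftK.
Qed.

Lemma lc_inv_subst (phi : lin_change R n) : lin_part (lc_mx phi) \in unitmx ->
  lc_inv phi =1 lin_subst (inv_affine (lc_mx phi)).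
Proof.
move=> u f; apply: (can_inj (lc_funK phi)).
by rewrite lc_invK lin_change_subst lin_subst_invK.
Qed.

Variables (R' : comUnitRingType) (r : {rmorphism R -> R'}).

Lemma map_lin_subst (A : 'M[R]_(n, n.+1)) f :
  map_mpoly r (lin_subst A f) = lin_subst (map_mx r A) (map_mpoly r f).
Proof.
apply: (mpoly_rmorph_ext (g := map_mpoly r \o lin_subst A)
          (h := lin_subst (map_mx r A) \o map_mpoly r)) => [a|i] /=.
  by rewrite /lin_subst map_mpolyC !comp_mpolyC map_mpolyC.
rewrite map_mpolyX !lin_substX /affine_form rmorphD /= map_mpolyC mxE.
congr (_ + _); rewrite rmorph_sum; apply: eq_bigr => j _ /=.
by rewrite map_mpolyZ map_mpolyX mxE.
Qed.

Lemma map_invmx_unit m (A : 'M[R]_m) : A \in unitmx ->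
  map_mx r (invmx A) = invmx (map_mx r A).
Proof.
move=> uA; have urA : map_mx r A \in unitmx.
  by rewrite unitmxE det_map_mx rmorph_unit // -unitmxE.
by rewrite -[LHS]mulmx1 -(mulmxV urA) mulmxA -map_mxM mulVmx // map_mx1 mul1mx.
Qed.

Lemma map_inv_affine (A : 'M[R]_(n, n.+1)) : lin_part A \in unitmx ->
  map_mx r (inv_affine A) = inv_affine (map_mx r A).
Proof.
move=> uA; apply/matrixP => i j; rewrite !mxE lin_part_map -map_invmx_unit //.
case: unliftP => [k _|_]; first by rewrite mxE.
rewrite rmorphN rmorph_sum; congr (- _); apply: eq_bigr => k _.
by rewrite rmorphM !mxE.
Qed.

End LinSubst.

(** * Vanishing of the border relations *)

Section OrderIdealLemmas.
Variables (n : nat) (o : seq 'X_{1..n}).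
Hypothesis oi : order_ideal o.

Lemma order_ideal0 : 0%MM \in o.
Proof.
have [_ o0 dv] := oi.
have [m mo] : exists m, m \in o.
  by case: (o) o0 => // m s _; exists m; rewrite mem_head.
by apply: (dv m) => //; apply/mnm_lepP => i; rewrite mnm0E.
Qed.

Lemma order_ideal_dvd m m' : (m + m')%MM \in o -> m' \in o.
Proof.
move=> h; have [_ _ dv] := oi; apply: (dv _ _ h); apply/mnm_lepP => i.
by rewrite mnmDE leq_addl.
Qed.

Lemma mem_border w : reflect (w \notin o /\ exists k m, m \in o /\ w = (U_(k) + m)%MM)
  (w \in border o).
Proof.
rewrite mem_filter mem_undup; apply: (iffP andP) => -[wo].
  by move=> /allpairsPdep[k [m [_ mo wE]]]; split=> //; exists k, m.
move=> [k [m [mo wE]]]; split=> //; apply/allpairsPdep; exists k, m.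
by rewrite mem_enum.
Qed.

Lemma border_termP (w : 'X_{1..n}) : w \in border o ->
  exists j : 'I_(size (border o)), w = border_term j.
Proof.
move=> wb; have h := wb; rewrite -index_mem in h; exists (Ordinal h).
by rewrite /border_term (tnth_nth w) /= nth_index.
Qed.

End OrderIdealLemmas.

Section BorderRelations.
Variables (S : comNzRingType) (n mu : nat) (o : mu.-tuple 'X_{1..n}).
Variables (J : ideal {mpoly S[n]}) (c : {linear {mpoly S[n]} -> 'cV[S]_mu}).
Hypothesis cP : coords J (fun i => 'X_[tnth o i]) c.

Definition mulmx_mod (k : 'I_n) : 'M[S]_mu :=
  \matrix_(i, m) c ('X_k * 'X_[tnth o m]) i 0.

Lemma mulmx_modE k f : c ('X_k * f) = mulmx_mod k *m c f.
Proof.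
rewrite mulrC (coords_mull cP) mulr_suml linear_sum; apply/colP => i.
rewrite summxE mxE; apply: eq_bigr => m _.
by rewrite -scalerAl linearZ !mxE mulrC (mulrC 'X_k).
Qed.

(** Both products represent multiplication by the product of the two
    indeterminates. *)
Lemma mulmx_mod_comm k l :
  mulmx_mod k *m mulmx_mod l = mulmx_mod l *m mulmx_mod k.
Proof.
suff E k' l' i m : (mulmx_mod k' *m mulmx_mod l') i m = c ('X_k' * ('X_l' * 'X_[tnth o m])) i 0.
  by apply/matrixP => i m; rewrite !E mulrCA.
rewrite mulmx_modE !mxE; apply: eq_bigr => p _; congr (_ * _).
by rewrite mxE.
Qed.

End BorderRelations.

Section BorderEval.
Variables (K : fieldType) (S : comNzRingType) (f : {rmorphism K -> S}).
Variables (n mu : nat) (o : mu.-tuple 'X_{1..n}).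
Hypothesis oi : order_ideal o.
Variables (J : ideal {mpoly S[n]}) (c : {linear {mpoly S[n]} -> 'cV[S]_mu}).
Hypothesis cP : coords J (fun i => 'X_[tnth o i]) c.
Local Notation nu := (size (border o)).

Definition border_mx : 'M[S]_(mu, nu) := \matrix_(i, j) c 'X_[border_term j] i 0.

(** A column of the formal matrix is a unit vector or a column of indeterminates,
    according to whether the product of the term with [x_k] stays in the order ideal
    or is a border term; in both cases it is evaluated to the coordinates of the
    product. *)
Lemma formal_mulmx_eval k :
  map_mx (meval (mxvec border_mx ord0) \o map_mpoly f) (formal_mulmx K o k)
  = mulmx_mod o c k.
Proof.
apply/matrixP => i m; rewrite !mxE -mpolyXD; set w := (_ + _)%MM; cbv zeta.
have inj : injective (tnth o) by apply/tuple_uniqP; case: oi.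
case: ifP => [wo|/negbT wo].
  have /tnthP[l wl] : w \in o by [].
  rewrite wl cP.2 (inj_eq inj).
  by rewrite !mxE eqxx andbT eq_sym rmorph_nat.
have /border_termP[j wj] : w \in border o.
  apply/mem_border; rewrite wo; split=> //; exists k, (tnth o m).
  by rewrite mem_tnth.
case: pickP => [j' /eqP wj'|/(_ j)]; last by rewrite wj eqxx.
by rewrite /= map_mpolyX mevalXU mxvecE mxE -wj'.
Qed.

Lemma border_ideal_eval h : border_ideal K o h ->
  (map_mpoly f h).@[mxvec border_mx ord0] = 0.
Proof.
move/(_ (comap_ideal (meval (mxvec border_mx ord0) \o map_mpoly f) (zero_ideal S))).
apply=> _ [k [l [i [m ->]]]] /=.
have /matrixP/(_ i m) := congr1 (fun A => A - mulmx_mod o c l *m mulmx_mod o c k)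
  (mulmx_mod_comm cP k l).
rewrite subrr [in RHS]mxE => <-.
by rewrite -!formal_mulmx_eval -!map_mxM -map_mxB [RHS]mxE.
Qed.

End BorderEval.

Section SchemeEval.
Variables (K : fieldType) (S : comNzRingType) (f : {rmorphism K -> S}).
Variables (n mu alpha : nat) (P : pseudo_order_ideal K n mu alpha).
Variables (J : ideal {mpoly S[n]}) (c : {linear {mpoly S[n]} -> 'cV[S]_mu}).
Hypothesis cP : coords J (t_ext P f) c.
Local Notation o := (poi_o P).

(** Precomposition with this substitution reduces the pseudo order ideal to the order
    ideal of terms; it is a ring endomorphism of [S[x]], whatever the ring [S]. *)
Definition pull_phi : {mpoly S[n]} -> {mpoly S[n]} :=
  comp_mpoly [tuple map_mpoly f (poi_phi P 'X_i) | i < n].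
HB.instance Definition _ := GRing.LRMorphism.copy pull_phi
  (comp_mpoly [tuple map_mpoly f (poi_phi P 'X_i) | i < n]).

Lemma pull_phiX m : pull_phi 'X_[m] = map_mpoly f (poi_phi P 'X_[m]).
Proof.
rewrite /pull_phi comp_mpolyX (mpolyXE_id _ m) !rmorph_prod.
by apply: eq_bigr => i _; rewrite tnth_mktuple !rmorphXn.
Qed.

Let c' : {linear {mpoly S[n]} -> 'cV[S]_mu} := c \o pull_phi.

Let c'P : coords (comap_ideal pull_phi J) (fun i => 'X_[tnth o i]) c'.
Proof.
by split=> [g|i]; rewrite /= ?pull_phiX; [exact: cP.1 | exact: cP.2].
Qed.

(** The indeterminates of the pseudo border scheme are sent to those attached to the
    selected border terms, so evaluation forgets the other columns. *)
Lemma relabel_eval (C : 'M[S]_(mu, size (border o))) h :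
  (map_mpoly f (relabel P h)).@[mxvec C ord0] =
  (map_mpoly f h).@[mxvec (\matrix_(i, j) C i (poi_e P j)) ord0].
Proof.
apply: (mpoly_rmorph_ext
  (g := meval (mxvec C ord0) \o map_mpoly f \o relabel P)
  (h := meval (mxvec (\matrix_(i, j) C i (poi_e P j)) ord0) \o map_mpoly f)) => [a|v] /=.
  by rewrite /relabel comp_mpolyC !map_mpolyC !mevalC.
rewrite /relabel comp_mpolyXU -tnth_nth tnth_mktuple map_mpolyX mevalXU.
case: (mxvec_indexP v) => i j.
by rewrite !mxvecE !mxE map_mpolyX mevalXU mxvecE.
Qed.

Lemma scheme_ideal_eval h : scheme_ideal P h ->
  (map_mpoly f h).@[mxvec (\matrix_(i, j) c (b_ext P f j) i 0) ord0] = 0.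
Proof.
move=> /= /(border_ideal_eval f (poi_order_ideal P) c'P).
rewrite relabel_eval => E; rewrite -[RHS]E; congr meval.
apply: funext => v; congr (mxvec _ _ _); apply/matrixP => i j.
by rewrite !mxE /= pull_phiX.
Qed.

End SchemeEval.

(** * Reduction to a pseudo order ideal *)

Section Reduction.
Variables (S : comNzRingType) (n mu : nat) (o : mu.-tuple 'X_{1..n}).
Hypothesis oi : order_ideal o.
Variables (J : ideal {mpoly S[n]}) (y : 'X_{1..n} -> {mpoly S[n]}).
Hypothesis yD : forall m m', y (m + m')%MM = y m * y m'.
Local Notation t i := (y (tnth o i)).

(** The restriction by [Q] on the terms that occur keeps track of the term ordering
    in the case of a cornercut. *)
Definition reducible (Q : 'X_{1..n} -> Prop) (g : {mpoly S[n]}) : Prop :=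
  exists a : 'I_mu -> S,
    (forall i, ~ Q (tnth o i) -> a i = 0) /\ J (g - \sum_i a i *: t i).

Lemma reducible_term (Q : 'X_{1..n} -> Prop) m : m \in o -> Q m -> reducible Q (y m).
Proof.
move=> /tnthP[i ->] Qi; exists (fun j => (j == i)%:R); split=> [j Qj|].
  by case: eqP => // ji; case: Qj; rewrite ji.
rewrite (bigD1 i) //= eqxx scale1r big1 ?addr0 ?subrr; first exact: ideal0.
by move=> j /negPf ->; rewrite scale0r.
Qed.

Lemma reducible_lin (Q : 'X_{1..n} -> Prop) k g h :
  reducible Q g -> reducible Q h -> reducible Q (k *: g + h).
Proof.
move=> [a [aQ Ja]] [b [bQ Jb]]; exists (fun i => k * a i + b i); split=> [i Qi|].
  by rewrite aQ // bQ // mulr0 addr0.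
have -> : k *: g + h - \sum_i (k * a i + b i) *: t i =
    k%:MP * (g - \sum_i a i *: t i) + (h - \sum_i b i *: t i).
  rewrite mul_mpolyC scalerBr addrACA -opprD; congr (_ - _).
  rewrite scaler_sumr -big_split; apply: eq_bigr => i _.
  by rewrite /= scalerDl scalerA.
by apply: idealD => //; apply: idealM.
Qed.

Lemma reducible0 Q : reducible Q 0.
Proof.
exists (fun=> 0); split=> //; rewrite big1 ?subrr; first exact: ideal0.
by move=> i _; rewrite scale0r.
Qed.

Lemma reducible_sum Q (I : Type) (r : seq I) (a : I -> S) (g : I -> {mpoly S[n]}) :
  (forall i, a i = 0 \/ reducible Q (g i)) -> reducible Q (\sum_(i <- r) a i *: g i).
Proof.
move=> Qg; elim: r => [|i r IH]; first by rewrite big_nil; apply: reducible0.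
rewrite big_cons; case: (Qg i) => [->|Qi]; first by rewrite scale0r add0r.
exact: reducible_lin.
Qed.

Lemma reducible_eq Q g h : J (g - h) -> reducible Q h -> reducible Q g.
Proof.
move=> Jgh [a [aQ Ja]]; exists a; split=> //.
by rewrite -[g](subrK h) -addrA; apply: idealD.
Qed.

Lemma reducible_mul Q Q' g h : reducible Q g ->
  (forall m, m \in o -> Q m -> reducible Q' (h * y m)) -> reducible Q' (h * g).
Proof.
move=> [a [aQ Ja]] Qh; apply: (@reducible_eq _ _ (\sum_i a i *: (h * t i))).
  rewrite [X in _ - X](_ : _ = h * \sum_i a i *: t i).
    by rewrite -mulrBr; apply: idealM.
  by rewrite mulr_sumr; apply: eq_bigr => i _; rewrite scalerAr.
apply: reducible_sum => i; have [Qi|/aQ ->] := pselect (Q (tnth o i)); last by left.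
by right; apply: Qh => //; apply: mem_tnth.
Qed.

Lemma border_reducible :
  (forall b, b \in border o -> reducible xpredT (y b)) -> y 0%MM = 1 ->
  forall m, reducible xpredT (y m).
Proof.
move=> bP y0 m; have [d md] := ubnP (mdeg m); elim: d m md => // d IH m md.
have [->|m0] := eqVneq m 0%MM; first by apply: reducible_term; rewrite ?order_ideal0.
have [k mk] : exists k, (0 < m k)%N.
  apply: contrapT => no; case/negP: m0; apply/eqP/mnmP => k; rewrite mnm0E.
  by apply/eqP; rewrite -leqn0 leqNgt; apply/negP => h; apply: no; exists k.
have mE : m = (U_(k) + (m - U_(k)))%MM.
  by rewrite addmC submK //; apply/mnm_lepP => l; rewrite mnm1E; case: eqP => [<-|].
rewrite mE yD; apply: (@reducible_mul xpredT).
  by apply: IH; move: md; rewrite {1}mE mdegD mdeg1.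
move=> m' m'o _; rewrite -yD.
have [h|h] := boolP ((U_(k) + m')%MM \in o); first exact: reducible_term.
by apply: bP; apply/mem_border; split=> //; exists k, m'.
Qed.

Variable le : rel 'X_{1..n}.
Hypothesis leP : term_ordering le.
Local Notation lt m m' := (le m m' /\ m <> m').

(** A border term that is not a corner is the product of an indeterminate and a
    smaller border term. Multiplying a reduction of the latter by the indeterminate
    only produces terms of the order ideal or its border which are smaller than the
    given one. The induction is on the number of smaller border terms, which is
    finite, so it does not use that term orderings are well-founded. *)
Lemma corner_reducible :
  (forall b, corner o b -> reducible (fun m => lt m b) (y b)) ->
  forall b, b \in border o -> reducible (fun m => lt m b) (y b).
Proof.
have [[[refl anti] [trans _]] [le0 leD]] : (((reflexive le /\ antisymmetric le) /\
    (transitive le /\ total le)) /\ ((forall m, le 0%MM m) /\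
    (forall m m1 m2, le m1 m2 -> le (m1 + m)%MM (m2 + m)%MM))).
  by case: leP => -[].
have ltD k m m' : lt m m' -> lt (k + m)%MM (k + m')%MM.
  move=> [mm' ne]; split; first by rewrite ![(k + _)%MM]addmC; apply: leD.
  by move=> /addmI.
have lt_trans m1 m2 m3 : lt m1 m2 -> lt m2 m3 -> lt m1 m3.
  move=> [l1 n1] [l2 n2]; split; first exact: trans l2.
  by move=> E; apply: n2; apply: anti; rewrite l2 -E l1.
pose ltb m m' := le m m' && (m != m').
have ltP m m' : reflect (lt m m') (ltb m m').
  by apply: (iffP andP) => -[l /eqP].
move=> cP b; pose N b := count (fun w => ltb w b) (border o).
have [d bd] := ubnP (N b); elim: d b bd => // d IH b bd bb.
have {}IH w : w \in border o -> lt w b -> reducible (fun m => lt m w) (y w).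
  move=> wb wlt; apply: IH => //; rewrite -ltnS; apply: leq_trans bd.
  rewrite ltnS /N -!size_filter.
  have -> : [seq u <- border o | ltb u w] =
      [seq u <- [seq u <- border o | ltb u b] | ltb u w].
    rewrite -filter_predI; apply: eq_in_filter => u _ /=.
    case: (ltP u w) => //= uw; rewrite (introT (ltP u b)) //; apply: lt_trans uw wlt.
  rewrite size_filter -(count_predC (fun u => ltb u w) [seq u <- border o | ltb u b]).
  rewrite -addn1 leq_add2l -has_count; apply/hasP; exists w.
    by rewrite mem_filter wb andbT; apply/ltP.
  by apply/negP => /ltP[].
have [bo [k [m [mo bE]]]] := mem_border _ _ bb.
have [/cP //|nc] := pselect (corner o b).
have [m' [m'o m'b m'ne]] : exists m', [/\ m' \notin o, (m' <= b)%MM & m' <> b].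
  apply: contrapT => no; apply: nc; split=> // m' m'o m'b.
  by apply: contrapT => ne; apply: no; exists m'.
have [l ml] : exists l, (m' l < b l)%N.
  apply: contrapT => no; apply: m'ne; apply/mnmP => l; apply/eqP.
  rewrite eqn_leq (mnm_lepP m'b) leqNgt; apply/negP => h; apply: no.
  by exists l.
pose w := (b - U_(l))%MM.
have bw : b = (U_(l) + w)%MM.
  rewrite addmC submK //; apply/mnm_lepP => i; rewrite mnm1E.
  by case: eqP => // <-; apply: leq_ltn_trans ml.
have wo : w \notin o.
  apply: contra m'o => wo; apply: (@order_ideal_dvd _ _ oi (w - m')%MM).
  rewrite submK //; apply/mnm_lepP => i; have := mnm_lepP m'b i.
  rewrite mnmBE mnm1E; case: eqP => [<- _|_]; last by rewrite subn0.
  by rewrite -ltnS subn1 prednK //; apply: leq_ltn_trans ml.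
(* Dividing by [x_k] would lead back into the order ideal. *)
have lk : l <> k.
  by move=> lk; case/negP: wo; rewrite -lk in bE; move: mo; rewrite -(addmI (_ : U_(l) + w = U_(l) + m)%MM) // -bw.
have ltU u : lt u (U_(l) + u)%MM.
  split; first by rewrite -{1}[u]add0m; apply: leD.
  by move=> /eqP; rewrite -{1}[u]add0m eqm_add2r eq_sym mnm1_eq0.
have wb : w \in border o.
  apply/mem_border; split=> //; exists k, (m - U_(l))%MM.
  have mU : (U_(l) <= m)%MM.
    apply/mnm_lepP => i; rewrite mnm1E; case: eqP => // <-.
    have : (0 < b l)%N by apply: leq_ltn_trans ml.
    by rewrite bE mnmDE mnm1E; case: eqP => // /esym.
  split; first by apply: (@order_ideal_dvd _ _ oi U_(l)%MM); rewrite addmC submK.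
  by rewrite /w bE addmBA.
have wlt : lt w b by have := ltU w; rewrite -bw.
rewrite bw yD; apply: reducible_mul (IH _ wb wlt) _ => u uo uw.
have ub : lt (U_(l) + u)%MM (U_(l) + w)%MM by apply: ltD.
rewrite -yD; have [h|h] := boolP ((U_(l) + u)%MM \in o).
  exact: reducible_term.
have hb : (U_(l) + u)%MM \in border o by apply/mem_border; split=> //; exists l, u.
have [|a [aQ Ja]] := IH _ hb; first by rewrite bw.
exists a; split=> // i ni; apply: aQ => h'; apply: ni; exact: lt_trans ub.
Qed.

End Reduction.

Section Span.
Variables (K : fieldType) (S : comNzRingType) (f : {rmorphism K -> S}).
Variables (n mu alpha : nat) (P : pseudo_order_ideal K n mu alpha).
Variable J : ideal {mpoly S[n]}.
Variable C : 'M[S]_(mu, alpha).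
Hypothesis JC : congr_mod J (b_ext P f) (t_ext P f) C.
Local Notation o := (poi_o P).
Let y m := map_mpoly f (poi_phi P 'X_[m]).

(** Terms are images of their preimages under the coordinate change, so it suffices
    to reduce the images of terms. *)
Lemma span_pseudo_border g : exists a : 'I_mu -> S,
  J (g - \sum_i a i *: t_ext P f i).
Proof.
have yD m m' : y (m + m')%MM = y m * y m' by rewrite /y mpolyXD !rmorphM.
have yX m : reducible o J y xpredT (y m).
  have oi := poi_order_ideal P; apply: border_reducible => //; last first.
    by rewrite /y mpolyX0 !rmorph1.
  case: (poi_case P) => [bP b /bP[j ->]|[le [leP cut cP]] b bb].
    by exists (fun i => C i j); split=> //; apply: JC.
  have cR b' : corner o b' -> reducible o J y (fun m => le m b' /\ m <> b') (y b').
    move=> cb; have /cP[j b'E] := cb; exists (fun i => C i j).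
    split; last by rewrite b'E; apply: JC.
    by move=> i; case; apply: cut => //; apply: mem_tnth.
  have [a [_ Ja]] := corner_reducible oi yD leP cR bb.
  by exists a; split.
suff [a [_ Ja]] : reducible o J y xpredT g by exists a.
rewrite (mpolyE g); apply: reducible_sum => // m; right.
have -> : 'X_[m] = map_mpoly f (poi_phi P (lc_inv (poi_phi P) 'X_[m])) :> {mpoly S[n]}.
  by rewrite lc_invK map_mpolyX.
set h := lc_inv _ _; rewrite (mpolyE h) linear_sum.
rewrite [map_mpoly f _](raddf_sum (map_mpoly f)) /=.
under eq_bigr => m' _ do rewrite linearZ /= map_mpolyZ.
by apply: reducible_sum => m'; right; apply: yX.
Qed.

End Span.

(** * Flatness from a finite dual basis *)

Section FlatFree.
Variables (R : comPzRingType) (N : lmodType R) (k : nat).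
Variables (e : 'I_k -> N) (d : 'I_k -> N -> R).
Hypothesis dD : forall l x y, d l (x + y) = d l x + d l y.
Hypothesis dZ : forall l a x, d l (a *: x) = a * d l x.
Hypothesis de : forall x, x = \sum_l d l x *: e l.

Section Component.
Variable M : lmodType R.

Definition component (l : 'I_k) : tensor M N -> M :=
  tensor_lift (fun (m : M) (x : N) => d l x *: m).

Fact component_balanced l : balanced (fun (m : M) (x : N) => d l x *: m).
Proof.
split=> [m m' x|m x x'|a m x]; first exact: scalerDr.
  by rewrite dD scalerDl.
by rewrite dZ !scalerA mulrC.
Qed.

Lemma component_pure l m x : component l (pure m x) = d l x *: m.
Proof. by rewrite [LHS]tensor_liftE //; apply: component_balanced. Qed.

Lemma componentB l : {morph component l : x y / x - y}.
Proof. by apply: tensor_liftB; apply: component_balanced. Qed.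

Lemma component0 l : component l 0 = 0.
Proof. by apply: tensor_lift0; apply: component_balanced. Qed.

Lemma pureBl (m m' : M) (x : N) : pure (m - m') x = pure m x - pure m' x.
Proof. by apply/eqP; rewrite eq_sym subr_eq -pureDl subrK. Qed.

Lemma pure_sumr (m : M) (r : seq 'I_k) (x : 'I_k -> N) :
  pure m (\sum_(l <- r) x l) = \sum_(l <- r) pure m (x l).
Proof.
elim: r => [|l r IH]; last by rewrite !big_cons pureDr IH.
by rewrite !big_nil; apply: (addIr (pure m 0)); rewrite -pureDr !add0r.
Qed.

Lemma component_sum z : z = \sum_l pure (component l z) (e l).
Proof.
elim/tensor_ind: z => [|x y hx hy|m x].
- rewrite big1 // => l _; rewrite component0.
  by rewrite -(subrr (0 : M)) pureBl subrr.
- rewrite {1}hx {1}hy -sumrB; apply: eq_bigr => l _.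
  by rewrite componentB pureBl.
rewrite {1}(de x) pure_sumr; apply: eq_bigr => l _.
by rewrite component_pure pureZ.
Qed.

End Component.

(** An element of the tensor product is determined by its components, and these are
    natural in the left factor. *)
Lemma flat_dual_basis : flat N.
Proof.
move=> M M' i injI.
have mapB : {morph tensor_map N i : x y / x - y}.
  by apply: tensor_liftB; apply: tensor_map_balanced.
have mapE m x : tensor_map N i (pure m x) = pure (i m) x.
  by rewrite [LHS]tensor_liftE //; apply: tensor_map_balanced.
have nat l z : component l (tensor_map N i z) = i (component l z).
  elim/tensor_ind: z => [|x y hx hy|m x].
  - by rewrite component0 raddf0 -[X in tensor_map _ _ X](subrr 0) mapB subrr component0.
  - by rewrite mapB !componentB raddfB hx hy.
  by rewrite mapE !component_pure linearZ.
move=> x y xy; apply/eqP; rewrite -subr_eq0 (component_sum (x - y)).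
rewrite big1 // => l _; have -> : component l (x - y) = 0.
  by apply: injI; rewrite raddf0 -nat mapB xy subrr component0.
by rewrite -(subrr (0 : M)) pureBl subrr.
Qed.

End FlatFree.

Lemma map_mpoly_comp_rmorph (R S T : comNzRingType) n (f : {rmorphism R -> S})
    (g : {rmorphism S -> T}) (h : {rmorphism R -> T}) (u : {mpoly R[n]}) :
  (forall a, h a = g (f a)) -> map_mpoly h u = map_mpoly g (map_mpoly f u).
Proof. by move=> E; apply/mpolyP => m; rewrite !mcoeff_map_mpoly; apply: E. Qed.

(** * Rational points of the scheme of linear coordinate changes *)

Section EvalChange.
Variables (K : fieldType) (n : nat) (B : 'M[K]_(n, n.+1)).
Hypothesis uB : lin_part B \in unitmx.

Fact meval_Delta_unit : meval (mxvec B ord0) (Delta K n) \is a GRing.unit.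
Proof.
rewrite /Delta -det_map_mx -unitmxE.
suff -> : map_mx (meval (mxvec B ord0)) (lin_part (gen_mx K n)) = lin_part B by [].
by apply/matrixP => i j; rewrite !mxE /= mevalXU mxvecE.
Qed.

Definition eval_change : Ka_Delta K n -> K := loc_lift (Delta_neq0 K n) meval_Delta_unit.
HB.instance Definition _ := GRing.RMorphism.copy eval_change
  (loc_lift (Delta_neq0 K n) meval_Delta_unit).

Lemma eval_changeE a : eval_change (Ka_in a) = a.@[mxvec B ord0].
Proof. exact: loc_liftE. Qed.

Lemma eval_change_const a : eval_change (K_in n a) = a.
Proof. by rewrite eval_changeE mevalC. Qed.

Lemma eval_change_mx : map_mx eval_change (gen_mxD K n) = B.
Proof. by apply/matrixP => i j; rewrite !mxE eval_changeE mevalXU mxvecE. Qed.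

End EvalChange.

Section RationalPoint.
Variables (K : fieldType) (n : nat) (p : Spec (Ka_Delta K n)) (phi : lin_change K n).
Hypothesis p_phi : represents p phi.

(** A prime does not contain the unit [Delta]. *)
Lemma represents_unit : lin_part (lc_mx phi) \in unitmx.
Proof.
have -> : lin_part (lc_mx phi) =
    map_mx (meval (mxvec (lc_mx phi) ord0)) (lin_part (gen_mx K n)).
  by apply/matrixP => i j; rewrite !mxE /= mevalXU mxvecE mxE.
rewrite unitmxE det_map_mx unitfE; apply/eqP => /p_phi pD.
apply: (@Spec_one _ p); rewrite -(mulVr (loc_in_unit (Delta_neq0 K n))).
exact: idealM.
Qed.

Lemma represents_kernel a : p a <-> eval_change represents_unit a = 0.
Proof.
have uD := loc_in_unit (Delta_neq0 K n).
have D0 := Delta_neq0 K n.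
have E := loc_numE D0 a.
have rE := congr1 (eval_change represents_unit) E.
rewrite rmorphM rmorphXn /= !eval_changeE in rE.
split=> [pa|ra].
  apply/eqP; have /eqP : (loc_num a).@[mxvec (lc_mx phi) ord0] = 0.
    by apply/p_phi; rewrite /Ka_in -E mulrC; apply: idealM.
  rewrite -rE mulf_eq0 expf_eq0 => /orP[//|/andP[_]].
  by have := meval_Delta_unit represents_unit; rewrite unitfE => /negPf ->.
have : p (loc_in _ (loc_num a)) by apply/p_phi; rewrite -rE ra mul0r.
rewrite -E => /Spec_prime[//|/Spec_exp pD].
by case: (@Spec_one _ p); rewrite -(mulVr uD); apply: idealM.
Qed.

Lemma represents_inv :
  lc_inv phi =1 lin_subst (inv_affine (map_mx (eval_change represents_unit) (gen_mxD K n))).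
Proof. by move=> g; rewrite eval_change_mx; apply: lc_inv_subst represents_unit _. Qed.

End RationalPoint.

(** * The generic linear change of coordinates *)

Section GenericChange.
Variables (K : fieldType) (n mu alpha : nat).
Variables (P : pseudo_order_ideal K n mu alpha) (I : ideal {mpoly K[n]}).
Variable c0 : {linear {mpoly K[n]} -> 'cV[K]_mu}.
Hypothesis c0P : coords I (poi_t P) c0.
Local Notation D := (Ka_Delta K n).
Local Notation iota := (@K_in K n).

Let c : {linear {mpoly D[n]} -> 'cV[D]_mu} := base_coords iota c0.

Let cP : coords (I_ext I iota) (t_ext P iota) c.
Proof. exact: base_coordsP. Qed.

(** For the pseudo order ideal and the pseudo border these are the generic matrices
    [M] and [N]. *)
Definition gen_coords_mx m (u : 'I_m -> {mpoly K[n]}) : 'M[D]_(mu, m) :=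
  \matrix_(i, j) c (lc_inv (gen_change K n) (map_mpoly iota (u j))) i 0.
Local Notation Mg := (gen_coords_mx (poi_t P)).
Local Notation Ng := (gen_coords_mx (poi_b P)).

Lemma is_M_genE M : is_M_gen P I M <-> M = Mg.
Proof. exact: change_coords. Qed.

Lemma is_N_genE N : is_N_gen P I N <-> N = Ng.
Proof. exact: change_coords. Qed.

Section Specialize.
Variables (F : comUnitRingType) (r : {rmorphism D -> F}) (f : {rmorphism K -> F}).
Hypothesis rf : forall a, f a = r (iota a).
Variables (phi : lin_change F n) (cF : {linear {mpoly F[n]} -> 'cV[F]_mu}).
Hypothesis phiE : lc_inv phi =1 lin_subst (inv_affine (map_mx r (gen_mxD K n))).
Hypothesis cFX : forall m, cF 'X_[m] = map_mx f (c0 'X_[m]).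

(** The coordinate maps and the inverse of the coordinate change are obtained by
    base change, so the matrices that they define are specializations of the
    generic ones. *)
Lemma gen_coords_mx_spec m (u : 'I_m -> {mpoly K[n]}) :
  \matrix_(i, j) cF (lc_inv phi (map_mpoly f (u j))) i 0 = map_mx r (gen_coords_mx u).
Proof.
apply/matrixP => i j; rewrite !mxE (map_mpoly_comp_rmorph (u j) rf) phiE.
rewrite -map_inv_affine ?gen_mxD_unit // -map_lin_subst.
rewrite (coords_natural (c := c)) ?mxE // => v.
by rewrite cFX [c _]base_coordsX; apply/matrixP => i' j'; rewrite !mxE rf.
Qed.

End Specialize.

Section Identity.

Let A : 'M[K]_(n, n.+1) :=
  \matrix_(i, j) if unlift ord0 j is Some k then (i == k)%:R else 0.

Let lin_A : lin_part A = 1%:M.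
Proof. by apply/matrixP => i j; rewrite !mxE liftK. Qed.

Let uA : lin_part A \in unitmx.
Proof. by rewrite lin_A unitmx1. Qed.

Let subst_A : lin_subst A =1 id.
Proof.
apply: (@lrmorph_id _ _ (lin_subst A)) => i.
rewrite /= lin_substX /affine_form mxE unlift_none mpolyC0 add0r.
rewrite (bigD1 i) //= mxE liftK eqxx scale1r big1 ?addr0 // => j ji.
by rewrite mxE liftK eq_sym (negPf ji) scale0r.
Qed.

Lemma gen_coords_mx_identity : map_mx (eval_change uA) Mg = 1%:M.
Proof.
rewrite -(@gen_coords_mx_spec _ _ idfun _ (mx_change uA) c0).
- apply/matrixP => i j; rewrite !mxE.
  have -> : map_mpoly idfun (poi_t P j) = poi_t P j.
    by apply/mpolyP => m; rewrite mcoeff_map_mpoly.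
  rewrite -[X in lc_inv _ X]subst_A (lc_funK (mx_change uA)) c0P.2.
  by rewrite mxE eqxx andbT.
- by move=> a; rewrite /= eval_change_const.
- by move=> g; rewrite eval_change_mx.
- by move=> m; rewrite map_mx_id.
Qed.

Lemma det_gen_neq0 : \det Mg != 0.
Proof.
apply/eqP => M0; have := congr1 determinant gen_coords_mx_identity.
by rewrite det_map_mx M0 rmorph0 det1 => /eqP; rewrite eq_sym oner_eq0.
Qed.

Lemma W_nonempty : exists p : Spec D, ~ p (\det Mg).
Proof.
by exists (generic_point D); apply/eqP/det_gen_neq0.
Qed.

End Identity.

Lemma point_change_mx (p : Spec D) m (u : 'I_m -> {mpoly K[n]}) N :
  change_mx (I_ext I (K_residue p)) (point_change p) (t_ext P (K_residue p))
    (fun j => map_mpoly (K_residue p) (u j)) N <->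
  N = map_mx (residue p) (gen_coords_mx u).
Proof.
rewrite (change_coords (base_coordsP (K_residue p) c0P)).
rewrite (gen_coords_mx_spec (r := residue p) (f := K_residue p)) // => v.
exact: base_coordsX.
Qed.

Lemma W_basic : W_open P I = [set p : Spec D | ~ p (\det Mg)].
Proof.
have unitE (p : Spec D) : (map_mx (residue p) Mg \in unitmx) = (residue p (\det Mg) != 0).
  by rewrite unitmxE det_map_mx unitfE.
apply/seteqP; split=> p.
  move=> [M [/point_change_mx -> ]]; rewrite unitE => /eqP h /residue_eq0.
  exact: h.
move=> h; exists (map_mx (residue p) Mg); split; first exact/point_change_mx.
by rewrite unitE; apply/eqP => /residue_eq0.
Qed.

(** * The homomorphism from the coordinate ring of the border basis scheme *)

Local Notation Lambda := (\det Mg).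
Local Notation T := (loc Lambda).
Local Notation inT := (loc_in Lambda).

Lemma map_gen_unit (F : comUnitRingType) (r : {rmorphism D -> F}) :
  r Lambda \is a GRing.unit -> map_mx r Mg \in unitmx.
Proof. by rewrite unitmxE det_map_mx. Qed.

(** The matrix representing the generic image ideal. *)
Definition gen_C : 'M[T]_(mu, alpha) := invmx (map_mx inT Mg) *m map_mx inT Ng.

Lemma inT_unit : map_mx inT Mg \in unitmx.
Proof. exact: map_gen_unit (loc_in_unit det_gen_neq0). Qed.

Lemma gen_C_frac : map_mx (@loc_val _ _) gen_C =
  invmx (map_mx (@tofrac D) Mg) *m map_mx (@tofrac D) Ng.
Proof.
have E m (A : 'M[D]_(mu, m)) : map_mx (@tofrac D) A = map_mx (@loc_val _ _) (map_mx inT A).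
  by apply/matrixP => i j; rewrite !mxE.
by rewrite !E map_mxM map_invmx_unit ?inT_unit.
Qed.

Definition K_inT : K -> T := inT \o iota.
HB.instance Definition _ := GRing.RMorphism.copy K_inT (inT \o iota).

Fact T_mx_unit : lin_part (map_mx inT (gen_mxD K n)) \in unitmx.
Proof.
by rewrite lin_part_map unitmxE det_map_mx rmorph_unit // -unitmxE gen_mxD_unit.
Qed.

Let phiT : lin_change T n := mx_change T_mx_unit.
Let cT : {linear {mpoly T[n]} -> 'cV[T]_mu} := base_coords K_inT c0.
Let IT : ideal {mpoly T[n]} := I_ext I K_inT.

Let cTP : coords IT (t_ext P K_inT) cT.
Proof. exact: base_coordsP. Qed.

Let T_change_mx m (u : 'I_m -> {mpoly K[n]}) :
  change_mx IT phiT (t_ext P K_inT) (fun j => map_mpoly K_inT (u j))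
    (map_mx inT (gen_coords_mx u)).
Proof.
apply/(change_coords cTP).
apply/esym; apply: gen_coords_mx_spec => // v.
exact: base_coordsX.
Qed.

Let JT : ideal {mpoly T[n]} := image_ideal phiT IT.
Let cJ : {linear {mpoly T[n]} -> 'cV[T]_mu} := image_coords cT phiT (map_mx inT Mg).

Let cJP : coords JT (t_ext P K_inT) cJ.
Proof. exact (image_coordsP cTP inT_unit (T_change_mx (poi_t P))). Qed.

Let JT_C : congr_mod JT (b_ext P K_inT) (t_ext P K_inT) gen_C.
Proof.
exact (image_coords_congr cTP inT_unit (T_change_mx (poi_t P)) (T_change_mx (poi_b P))).
Qed.

Local Notation Kc := {mpoly K[mu * alpha]}.

Definition eval_C : Kc -> T := meval (mxvec gen_C ord0) \o map_mpoly K_inT.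
HB.instance Definition _ := GRing.RMorphism.copy eval_C
  (meval (mxvec gen_C ord0) \o map_mpoly K_inT).

Lemma eval_C_const k : eval_C k%:MP = inT (iota k).
Proof. by rewrite /eval_C /= map_mpolyC mevalC. Qed.

Lemma eval_C_var i j : eval_C 'X_(mxvec_index i j) = gen_C i j.
Proof. by rewrite /eval_C /= map_mpolyX mevalXU mxvecE. Qed.

(** [gen_C] consists of the coordinates of the pseudo border for a coordinate map
    over [T]. *)
Lemma eval_C_scheme h : scheme_ideal P h -> eval_C h = 0.
Proof.
move=> hh; rewrite /eval_C /= ((congr_coords cJP _ _).1 JT_C).
exact: scheme_ideal_eval cJP _ hh.
Qed.

Definition gen_psi : B_ring P -> T := quot_lift eval_C_scheme.
HB.instance Definition _ := GRing.RMorphism.copy gen_psi (quot_lift eval_C_scheme).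

Lemma gen_psiE h : gen_psi (Kc_proj P h) = eval_C h.
Proof. exact: (quot_liftE eval_C_scheme h). Qed.

Definition is_psi (psi : {rmorphism B_ring P -> T}) : Prop :=
  (forall k : K, psi (Kc_proj P k%:MP) = inT (iota k)) /\
  (forall i j, loc_val (psi (Kc_proj P (cvar K i j)))
     = (invmx (map_mx (@tofrac D) Mg) *m map_mx (@tofrac D) Ng) i j).

Lemma gen_psiP : is_psi gen_psi.
Proof.
split=> [k|i j].
  by rewrite -eval_C_const -gen_psiE.
by rewrite -gen_C_frac mxE -(eval_C_var i j) -gen_psiE.
Qed.

Section Psi.
Variable psi : {rmorphism B_ring P -> T}.
Hypothesis psiP : is_psi psi.

Lemma psi_eval h : psi (Kc_proj P h) = eval_C h.
Proof.
move: h; apply: (mpoly_rmorph_ext (g := psi \o Kc_proj P) (h := eval_C)) => [k|v] /=.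
  by rewrite psiP.1 eval_C_const.
case: (mxvec_indexP v) => i j; rewrite eval_C_var.
by apply: val_inj; have := psiP.2 i j; rewrite -gen_C_frac mxE.
Qed.

Section Point.
Variables (F : fieldType) (r : {rmorphism D -> F}) (f : {rmorphism K -> F}).
Hypothesis rf : forall a, f a = r (iota a).
Variables (p : Spec D) (Phip : B_ring P -> Prop).
Hypotheses (pr : forall a, p a <-> r a = 0) (pL : ~ p Lambda).
Hypothesis PhipP : forall b, Phip b <->
  exists x : D * D, [/\ p x.1, ~ p x.2 & loc_val (psi b) = Defs.frac x].

Let rL : r Lambda \is a GRing.unit.
Proof. by rewrite unitfE; apply/eqP => /pr. Qed.

(** Both sides say that the extension of [r] to the localization annihilates the
    value of [psi] at [h]; this extension maps the generic matrix to the matrix of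
    the point. *)
Lemma point_psi h : Phip (Kc_proj P h) <->
  (map_mpoly f h).@[mxvec (invmx (map_mx r Mg) *m map_mx r Ng) ord0] = 0.
Proof.
pose r' : {rmorphism T -> F} := loc_lift det_gen_neq0 rL.
have r'E a : r' (inT a) = r a by apply: loc_liftE.
rewrite PhipP -(loc_kernel (r := r') det_gen_neq0); last by move=> a; rewrite r'E.
suff -> : r' (psi (Kc_proj P h)) =
   (map_mpoly f h).@[mxvec (invmx (map_mx r Mg) *m map_mx r Ng) ord0] by [].
rewrite psi_eval; have E m (A : 'M[D]_(mu, m)) : map_mx r A = map_mx r' (map_mx inT A).
  by apply/matrixP => i j; rewrite !mxE r'E.
rewrite !E -map_invmx_unit ?inT_unit // -map_mxM -/gen_C.
apply: (mpoly_rmorph_ext (g := r' \o eval_C)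
   (h := meval (mxvec (map_mx r' gen_C) ord0) \o map_mpoly f)) => [k|v] /=.
  by rewrite eval_C_const map_mpolyC mevalC r'E; apply: esym; apply: rf.
case: (mxvec_indexP v) => i j.
by rewrite eval_C_var map_mpolyX mevalXU mxvecE [RHS]mxE.
Qed.

Variables (phi : lin_change F n) (J : ideal {mpoly F[n]}).
Variables (t : 'I_mu -> {mpoly F[n]}) (b : 'I_alpha -> {mpoly F[n]}).
Variable cF : {linear {mpoly F[n]} -> 'cV[F]_mu}.
Hypothesis cFP : coords J t cF.

Lemma image_ideal_at_point Mphi Nphi :
  change_mx J phi t t Mphi -> change_mx J phi t b Nphi ->
  Mphi = map_mx r Mg -> Nphi = map_mx r Ng ->
  let C := invmx Mphi *m Nphi in
  [/\ Mphi \in unitmx, basis_mod (image_ideal phi J) t,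
      congr_mod (image_ideal phi J) b t C &
      forall h, Phip (Kc_proj P h) <-> (map_mpoly f h).@[mxvec C ord0] = 0].
Proof.
move=> hM hN ME NE C; have uM : Mphi \in unitmx by rewrite ME; apply: map_gen_unit.
split=> //.
- exact: coords_basis (image_coordsP cFP uM hM).
- exact (image_coords_congr cFP uM hM hN).
by move=> h; rewrite /C ME NE; apply: point_psi.
Qed.

End Point.

(** * Flatness of the universal family over the open set *)

Let UI := universal_ideal P.
Let mapT : {rmorphism {mpoly Kc[n]} -> {mpoly T[n]}} := map_mpoly eval_C.
Local Notation mC := (@mpolyC (mu * alpha) K).

Let ext_eval (u : {mpoly K[n]}) : mapT (map_mpoly mC u) = map_mpoly K_inT u.
Proof.
apply/esym/(map_mpoly_comp_rmorph (f := mC) (g := eval_C) (h := K_inT)) => a.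
by rewrite /= eval_C_const.
Qed.

Let mapTZ a g : mapT (a *: g) = eval_C a *: mapT g.
Proof. exact: map_mpolyZ. Qed.

(** The generators [g_j] are mapped into the image ideal because [gen_C] represents
    it. *)
Let UI_coords g : UI g -> cJ (mapT g) = 0.
Proof.
move=> /(_ (comap_ideal mapT JT)) h; apply/cJP.1/h => {h} _ [[h hh ->]|[j ->]].
  have hE : mapT h%:MP = 0.
    by rewrite -[h%:MP]mulr1 mul_mpolyC mapTZ (eval_C_scheme hh) scale0r.
  have := ideal0 JT; rewrite -hE; apply.
have gE : mapT (generic_g P j) = b_ext P K_inT j - \sum_i gen_C i j *: t_ext P K_inT i.
  have E1 : mapT (map_mpoly mC (poi_b P j)) = b_ext P K_inT j by exact: ext_eval.
  have E2 : mapT (\sum_i cvar K i j *: map_mpoly mC (poi_t P i)) =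
      \sum_i gen_C i j *: t_ext P K_inT i.
    apply: (etrans (rmorph_sum mapT _ _ _)); apply: eq_bigr => i _.
    apply: (etrans (mapTZ _ _)); by rewrite ext_eval /cvar eval_C_var.
  have -> : generic_g P j = map_mpoly mC (poi_b P j) -
      \sum_i cvar K i j *: map_mpoly mC (poi_t P i) by [].
  rewrite -E1 -E2; exact: (rmorphB mapT).
have := JT_C j; rewrite -gE; apply.
Qed.

(** The universal family maps to the quotient by the image ideal, where coordinates
    are available. *)
Definition U_coords (u : U_ring P) : 'cV[T]_mu := cJ (mapT (generic_quotient.repr u)).

Lemma U_coordsE g : U_coords (qproj _ g) = cJ (mapT g).
Proof.
apply/eqP; rewrite -subr_eq0 -linearB -(rmorphB mapT); apply/eqP/UI_coords.
by apply/qproj_eq; rewrite /qproj generic_quotient.reprK.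
Qed.

Lemma U_coordsD u v : U_coords (u + v) = U_coords u + U_coords v.
Proof.
case: (qproj_surj u) (qproj_surj v) => g -> [h ->].
by rewrite -rmorphD !U_coordsE (rmorphD mapT) linearD.
Qed.

Lemma U_coords_scale b u : U_coords (B_to_U P b * u) = psi b *: U_coords u.
Proof.
case: (qproj_surj b) (qproj_surj u) => h -> [g ->].
rewrite /B_to_U quot_mapE -rmorphM !U_coordsE mul_mpolyC mapTZ linearZ.
by rewrite -psi_eval.
Qed.

Local Notation UT := (alg_tensor (B_to_U P) psi).

Definition UT_coords : UT -> 'cV[T]_mu :=
  @tensor_lift _ (restr (B_to_U P)) (restr psi) _
    (fun (u : U_ring P) (x : T) => x *: U_coords u).

Fact UT_coords_balanced :
  @balanced _ (restr (B_to_U P)) (restr psi) _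
    (fun (u : U_ring P) (x : T) => x *: U_coords u).
Proof.
split=> [u v x|u x y|b u x].
- by rewrite -scalerDr -U_coordsD.
- exact: scalerDl.
by rewrite !restr_scaleE U_coords_scale scalerA mulrC.
Qed.

Lemma UT_coordsE u x : UT_coords (apure (B_to_U P) psi u x) = x *: U_coords u.
Proof. exact (tensor_liftE UT_coords_balanced u x). Qed.

Lemma UT_coordsB : {morph UT_coords : x y / x - y}.
Proof. exact (tensor_liftB UT_coords_balanced). Qed.

Lemma UT_coordsD : {morph UT_coords : x y / x + y}.
Proof. exact (tensor_liftD UT_coords_balanced). Qed.

Lemma UT_coords0 : UT_coords 0 = 0.
Proof. exact (tensor_lift0 UT_coords_balanced). Qed.

Local Notation inr := (@alg_tensor_inr _ _ _ (B_to_U P) psi).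

Lemma UT_coordsZ a x : UT_coords (inr a * x) = a *: UT_coords x.
Proof.
elim/apure_ind: x => [|x y hx hy|u x].
- by rewrite mulr0 UT_coords0 scaler0.
- by rewrite mulrBr !UT_coordsB hx hy scalerBr.
by rewrite [inr a * _]at_mulE mul1r !UT_coordsE scalerA.
Qed.

Definition UT_basis (i : 'I_mu) : UT :=
  apure (B_to_U P) psi (qproj _ (t_ext P (@mpolyC (mu * alpha) K) i)) 1.

(** Reduction to the pseudo order ideal is possible over the polynomial ring in the
    [c_ij], and the coefficients are moved across the tensor product. *)
Lemma UT_basis_coords (x : UT) : x = \sum_i inr (UT_coords x i 0) * UT_basis i.
Proof.
elim/apure_ind: x => [|x y hx hy|u x].
- by rewrite UT_coords0 big1 // => i _; rewrite mxE rmorph0 mul0r.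
- rewrite {1}hx {1}hy -sumrB; apply: eq_bigr => i _.
  by rewrite UT_coordsB !mxE rmorphB mulrBl.
have [g ->] := qproj_surj u.
have Cc : congr_mod UI (b_ext P (@mpolyC (mu * alpha) K)) (t_ext P (@mpolyC (mu * alpha) K))
    (\matrix_(i, j) cvar K i j).
  move=> j J EJ; apply: EJ; right; exists j; congr (_ - _).
  by apply: eq_bigr => i _; rewrite mxE.
have [a /qproj_eq ->] := span_pseudo_border Cc g.
rewrite UT_coordsE U_coordsE.
have -> : cJ (mapT (\sum_i a i *: t_ext P (@mpolyC (mu * alpha) K) i)) = \col_i eval_C (a i).
  rewrite -(coords_sum cJP); congr (cJ _); rewrite (rmorph_sum mapT); apply: eq_bigr => i _.
  by rewrite mapTZ ext_eval.
rewrite rmorph_sum.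
have sumE (r : seq 'I_mu) (v : 'I_mu -> U_ring P) :
    apure (B_to_U P) psi (\sum_(i <- r) v i) x = \sum_(i <- r) apure (B_to_U P) psi (v i) x.
  have apD (u' v' : U_ring P) : apure (B_to_U P) psi (u' + v') x =
      apure (B_to_U P) psi u' x + apure (B_to_U P) psi v' x.
    exact: (@pureDl _ (restr (B_to_U P)) (restr psi)).
  elim: r => [|i r IH]; last by rewrite !big_cons apD IH.
  by rewrite !big_nil; apply: (addIr (apure (B_to_U P) psi 0 x)); rewrite -apD !add0r.
rewrite sumE; apply: eq_bigr => i _.
rewrite [RHS]at_mulE mul1r mulr1 !mxE mulrC -psi_eval.
have E : qproj UI (a i *: t_ext P mC i) =
    B_to_U P (Kc_proj P (a i)) * qproj UI (t_ext P mC i).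
  by rewrite /B_to_U quot_mapE -rmorphM mul_mpolyC.
apply: (etrans (congr1 (fun v : U_ring P => apure (B_to_U P) psi v x) E)).
exact: (@pureZ _ (restr (B_to_U P)) (restr psi)).
Qed.

Lemma flat_universal_family : flat_rmorphism inr.
Proof.
apply (@flat_dual_basis T (restr inr) mu UT_basis (fun i x => UT_coords x i 0)).
- by move=> i x y; rewrite UT_coordsD mxE.
- by move=> i a x; rewrite restr_scaleE UT_coordsZ mxE.
exact: UT_basis_coords.
Qed.

End Psi.
End GenericChange.

Theorem proposition2p12 (K : fieldType) (n mu alpha : nat)
    (P : pseudo_order_ideal K n mu alpha) (I : ideal {mpoly K[n]})
    (basisP : basis_mod I (poi_t P)) :
  let W := W_open P I in
  [/\ zopen W /\ W !=set0,
      (exists M, is_M_gen P I M) /\ (exists N, is_N_gen P I N) &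
      forall M : 'M[Ka_Delta K n]_mu, is_M_gen P I M ->
      let Lambda := \det M in
      has_coordinate_ring W Lambda /\
      forall N : 'M[Ka_Delta K n]_(mu, alpha), is_N_gen P I N ->
      let MQ := map_mx (@tofrac (Ka_Delta K n)) M in
      let NQ := map_mx (@tofrac (Ka_Delta K n)) N in
      let is_psi (psi : {rmorphism B_ring P -> loc Lambda}) :=
        (forall k : K, psi (Kc_proj P k%:MP) = loc_in Lambda (K_in n k)) /\
        (forall i j, loc_val (psi (Kc_proj P (cvar K i j)))
                     = (invmx MQ *m NQ) i j) in
      [/\ MQ \in unitmx /\
          (forall i j, (invmx MQ *m NQ) i j \in loc_pred Lambda),
          exists psi, is_psi psi &
          forall psi, is_psi psi ->
          (exists Phi : Spec (Ka_Delta K n) -> Spec (B_ring P),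
            [/\ induced_morphism W (fun u => loc_val (psi u)) Phi,
                forall p phi, W p -> represents p phi ->
                forall Mphi Nphi,
                  change_mx I phi (poi_t P) (poi_t P) Mphi ->
                  change_mx I phi (poi_t P) (poi_b P) Nphi ->
                  let C := invmx Mphi *m Nphi in
                  [/\ Mphi \in unitmx,
                      basis_mod (image_ideal phi I) (poi_t P),
                      congr_mod (image_ideal phi I) (poi_b P) (poi_t P) C &
                      forall f, Phi p (Kc_proj P f) <-> f.@[mxvec C ord0] = 0] &
                forall p, W p ->
                let phi := point_change p in
                let Ip := I_ext I (K_residue p) in
                let t := t_ext P (K_residue p) in
                let b := b_ext P (K_residue p) in
                forall Mphi Nphi,
                  change_mx Ip phi t t Mphi -> change_mx Ip phi t b Nphi ->
                  let C := invmx Mphi *m Nphi in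
                  [/\ Mphi \in unitmx,
                      basis_mod (image_ideal phi Ip) t,
                      congr_mod (image_ideal phi Ip) b t C &
                      forall f, Phi p (Kc_proj P f) <->
                        (map_mpoly (K_residue p) f).@[mxvec C ord0] = 0]]) /\
          flat_rmorphism (@alg_tensor_inr _ _ _ (B_to_U P) psi)]].
Proof.
move=> W; have [c0 c0P] := basis_coords basisP.
have WE : W = [set p : Spec (Ka_Delta K n) | ~ p (\det (gen_coords_mx c0 (poi_t P)))].
  exact: W_basic.
split.
- split; first by rewrite WE; apply: zopen_basic.
  by rewrite WE; have [p pW] := W_nonempty c0P; exists p.
- by split; eexists; [apply/(is_M_genE c0P)|apply/(is_N_genE c0P)].
move=> M /(is_M_genE c0P) -> {M} Lambda; have L0 : Lambda != 0 by apply: det_gen_neq0 c0P.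
split; first by rewrite WE; apply: basic_open_coordinate_ring.
move=> N /(is_N_genE c0P) -> {N} MQ NQ is_psi.
have CE : invmx MQ *m NQ = map_mx (@loc_val _ _) (gen_C P c0) by rewrite (gen_C_frac c0P).
split.
- split; last by move=> i j; rewrite CE mxE; apply: loc_valP.
  by apply: (map_gen_unit (r := @tofrac _)); rewrite unitfE tofrac_eq0.
- by exists (gen_psi c0P); apply: gen_psiP.
move=> psi psiP; split; last exact: flat_universal_family c0P psi psiP.
have [Phi PhiP] := induced_morphism_exists L0 psi.
exists Phi; rewrite WE; split; first exact: PhiP.
- move=> p phi pL rep Mphi Nphi hM hN.
  pose r : {rmorphism Ka_Delta K n -> K} := eval_change (represents_unit rep).
  have rK a : idfun a = r (K_in n a) by exact (esym (eval_change_const (represents_unit rep) a)).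
  have spec m (u : 'I_m -> {mpoly K[n]}) : \matrix_(i, j) c0 (lc_inv phi (u j)) i 0 =
      map_mx r (gen_coords_mx c0 u).
    have c0X v : c0 'X_[v] = map_mx idfun (c0 'X_[v]) by rewrite map_mx_id.
    rewrite -(gen_coords_mx_spec rK (represents_inv rep) c0X u).
    apply/matrixP => i j; rewrite !mxE.
    suff -> : map_mpoly idfun (u j) = u j by [].
    by apply/mpolyP => v; rewrite mcoeff_map_mpoly.
  have [_ PhipP _] := PhiP.
  have [uM bas cong pt] := image_ideal_at_point c0P psiP rK (represents_kernel rep) pL
    (PhipP p pL) c0P hM hN (etrans ((change_coords c0P _ _ _).1 hM) (spec _ _))
     (etrans ((change_coords c0P _ _ _).1 hN) (spec _ _)).
  split=> // f; rewrite pt; suff -> : map_mpoly idfun f = f by [].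
  by apply/mpolyP => v; rewrite mcoeff_map_mpoly.
move=> p pL phi Ip t b Mphi Nphi hM hN.
have [_ PhipP _] := PhiP.
apply: (image_ideal_at_point c0P psiP (r := residue p) (f := K_residue p) _ _ pL
  (PhipP p pL) (base_coordsP (K_residue p) c0P) hM hN) => //.
- by move=> a; rewrite residue_eq0.
- exact/(point_change_mx c0P).
exact/(point_change_mx c0P).
Qed.
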